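(* Let $G$ be a locally compact second countable abelian group. Let $(Z,\theta)$ be a standard Borel probability measure space and let $a_1,\ldots,a_r$ be commuting $\theta$-preserving Borel $G$-actions on $Z$. Then, for every $\theta$-measurable set $A\subset Z$ with positive $\theta$-measure, there exists $c>0$ such that the set $$S:=\Big\{g\in G : \theta\Big(A\cap\Big(\bigcap_{k=1}^r a_k(g,A)\Big)\Big)\ge c\Big\}$$ is syndetic in $G$. In particular, for every strong F\o lner sequence $(F_n)$ in $G$, $$\varliminf_{n\to\infty}\frac{1}{m_G(F_n)}\int_{F_n}\theta\Big(A\cap\Big(\bigcap_{k=1}^r a_k(g,A)\Big)\Big)\,dm_G(g)>0 .$$
   Context: $G$ is written additively; topological groups are Hausdorff; $m_G$ is a fixed Haar measure; ''bounded'' means relatively compact. Two Borel $G$-actions $a,b:G\times Z\to Z$ commute if $a(g_1,b(g_2,z))=b(g_2,a(g_1,z))$ for all $g_1,g_2\in G$, $z\in Z$; ''commuting actions'' means pairwise commuting. $a_k(g,A)=\{a_k(g,z): z\in A\}$. A set $S\subset G$ is syndetic in $G$ if there is a finite set $F\subset G$ with $S+F=G$. A strong F\o lner sequence in $G$ is a sequence $(F_n)$ of bounded Borel sets of positive Haar measure such that (i) $\lim_{n}\frac{m_G(F_n+C)}{m_G(F_n)}=1$ for every compact $C\subset G$; and (ii) there is an open bounded identity neighbourhood $V$ with $\lim_n\frac{m_G(\bigcap_{v\in V}(F_n-v))}{m_G(F_n)}=1$. *)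

(* Defs.v *)
From HB Require Import structures.
From mathcomp Require Import all_boot all_order all_algebra.
From mathcomp Require Import all_classical all_reals all_analysis.
From mathcomp Require Import measurable_realfun.

Set Implicit Arguments.
Unset Strict Implicit.
Unset Printing Implicit Defensive.

Import Order.TTheory GRing.Theory Num.Theory.
Import numFieldNormedType.Exports.

Local Open Scope classical_set_scope.
Local Open Scope ring_scope.

(* The library only puts [g_sigma_algebraType] on pointed types, and a
   topological group is not canonically pointed: [borelType G] is a copy of [G],
   pointed at 0, whose measurable sets are the Borel sets. *)
Definition borelType (G : topologicalZmodType) : Type := G.

Section borelType_instances.
Variable G : topologicalZmodType.

HB.instance Definition _ := TopologicalZmodule.on (borelType G).
HB.instance Definition _ := isPointed.Build (borelType G) (0 : G).
HB.instance Definition _ := @isMeasurable.Build (sigma_display (@open G))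
  (borelType G) <<s @open G >>
  (@sigma_algebra0 _ setT (@open G)) (@sigma_algebraC (borelType G) (@open G))
  (@sigma_algebra_bigcup _ setT (@open G)).

End borelType_instances.

Notation completed mu := (@completed_measure_extension _ _ _ mu).

Section haar.
Variables (R : realType) (G : topologicalZmodType).

(* On a locally compact second countable group, a Borel measure that is finite
   on compact sets is automatically regular, so regularity is not required. *)
Definition haar_measure (m : {measure set (borelType G) -> \bar R}) : Prop :=
  [/\ m [set: G] != 0%E,
      forall K : set G, compact K -> (m K < +oo)%E &
      forall (g : G) (B : set (borelType G)), measurable B ->
        m ([set g + x | x in (B : set G)] : set G) = m B].

(* [F n + C] and the intersection of translates need not be Borel a priori
   (the former is only analytic in general), hence the completion of [m].
   The compact set [C] has to be nonempty, since [F n + set0 = set0]. *)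
Definition strong_folner (m : {measure set (borelType G) -> \bar R})
    (F : (set G)^nat) : Prop :=
  [/\ forall n, [/\ measurable (F n : set (borelType G)),
                    precompact (F n) & (0 < m (F n))%E],
      forall C : set G, compact C -> C !=set0 ->
        (completed m [set (x + y)%R | x in F n & y in C]
           / m (F n))%E @[n --> \oo] --> 1%E &
      exists V : set G, [/\ open V, precompact V, V 0 &
        (completed m
             (\bigcap_(v in V) [set (x - v)%R | x in F n])
           / m (F n))%E @[n --> \oo] --> 1%E]].

End haar.

Definition syndetic (G : zmodType) (S : set G) : Prop :=
  exists2 F : set G, finite_set F & [set s + f | s in S & f in F] = setT.

(* A Hausdorff (ball-based) pseudometric space is metrizable, so [P] below is
   a Polish space. *)
Definition standard_borel (R : realType) d (Z : measurableType d) : Prop :=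
  exists (P : completePseudoMetricType R) (D : set P) (f : Z -> P),
    [/\ hausdorff_space P, countable D, dense D, bijective f &
        forall B : set P, measurable (f @^-1` B) <-> <<s @open P >> B].

Section actions.
Variables (G : topologicalZmodType) (d : measure_display) (Z : measurableType d).
Implicit Types a b : G -> Z -> Z.

Definition borel_action a : Prop :=
  [/\ forall z, a 0 z = z,
      forall g h z, a (g + h) z = a g (a h z) &
      measurable_fun [set: borelType G * Z] (fun p => a p.1 p.2)].

Definition commuting_actions a b : Prop :=
  forall g1 g2 z, a g1 (b g2 z) = b g2 (a g1 z).

Definition preserves (R : realType) (theta : set Z -> \bar R) a : Prop :=
  forall g (B : set Z), measurable B -> theta (a g @^-1` B) = theta B.

End actions.

(* Main.v *)
(* For Borel [A] of measure [delta] and [g_1, ..., g_N] in [G], let a word [w] in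
   [{0, ..., r}^N] act through [prod_i a_(w_i)(g_i)], where [a_0] is trivial.  All
   preimages of [A] have measure [delta], so a typical point lies in a dense set
   of them, and by the density Hales-Jewett theorem this set contains a
   combinatorial line.  The words of a line differ by [a_k(h)], where [h] is the
   sum of the [g_i] over the wildcards; hence the set of return times meets every
   set of finite sums of a long enough sequence, with a constant [c] depending
   only on [delta] and [r], and is therefore syndetic.

   The density Hales-Jewett theorem is proved as by Polymath and by Dodos,
   Kanellopoulos and Tyros, by induction on the alphabet.  At the critical density
   a line-free set has nearly the same density in every large subspace; the
   induction hypothesis and the colouring theorem then make it denser on an
   intersection of sets that are insensitive to swapping two letters, and such
   intersections are tiled by subspaces. *)
Require Import Defs.
From mathcomp Require Import all_boot all_order all_algebra.
From mathcomp Require Import all_classical all_reals all_analysis.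
From mathcomp Require Import measurable_realfun.
From mathcomp Require Import lra ring.

Set Implicit Arguments.
Unset Strict Implicit.
Unset Printing Implicit Defensive.

Import Order.TTheory GRing.Theory Num.Theory.
Import numFieldNormedType.Exports.

Local Open Scope classical_set_scope.
Local Open Scope ring_scope.

(** * Averages and densities *)

Section average.
Variable R : realType.

Definition avg (T : finType) (f : T -> R) : R := (\sum_x f x) / #|T|%:R.

Lemma le_avg (T : finType) (f g : T -> R) :
  (forall x, f x <= g x) -> avg f <= avg g.
Proof. by move=> fg; rewrite ler_wpM2r ?invr_ge0 ?ler0n // ler_sum. Qed.

Lemma eq_avg (T : finType) (f g : T -> R) : f =1 g -> avg f = avg g.
Proof. by move=> fg; congr (_ / _); apply: eq_bigr. Qed.

Lemma avg_cst (T : finType) (c : R) : (0 < #|T|)%N -> avg (fun _ : T => c) = c.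
Proof.
move=> T0; rewrite /avg sumr_const -(mulr_natr c) mulfK // pnatr_eq0.
by rewrite -lt0n.
Qed.

Lemma avg_ge0 (T : finType) (f : T -> R) : (forall x, 0 <= f x) -> 0 <= avg f.
Proof. by move=> f0; rewrite mulr_ge0 ?invr_ge0 ?ler0n// sumr_ge0. Qed.

Lemma avgD (T : finType) (f g : T -> R) :
  avg (fun x => f x + g x) = avg f + avg g.
Proof. by rewrite /avg big_split mulrDl. Qed.

Lemma avgZ (T : finType) (c : R) (f : T -> R) :
  avg (fun x => c * f x) = c * avg f.
Proof. by rewrite /avg -mulr_sumr mulrA. Qed.

Lemma avgB (T : finType) (f g : T -> R) :
  avg (fun x => f x - g x) = avg f - avg g.
Proof. by rewrite /avg sumrB mulrBl. Qed.

Lemma avg_sum (T L : finType) (P : pred L) (f : L -> T -> R) :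
  avg (fun x => \sum_(l | P l) f l x) = \sum_(l | P l) avg (f l).
Proof. by rewrite /avg exchange_big mulr_suml. Qed.

Lemma exchange_avg (S T : finType) (f : S -> T -> R) :
  avg (fun x => avg (fun y => f x y)) = avg (fun y => avg (fun x => f x y)).
Proof.
rewrite /avg -2!mulr_suml exchange_big /=.
by rewrite -!mulrA; congr (_ * _); rewrite mulrC.
Qed.

Lemma avg_bij (S T : finType) (h : S -> T) (f : T -> R) :
  bijective h -> avg f = avg (fun x => f (h x)).
Proof.
by move=> hb; rewrite /avg (reindex h) ?(bij_eq_card hb)//=; apply: onW_bij.
Qed.

Lemma ler_avg_exists (T : finType) (f : T -> R) c :
  (0 < #|T|)%N -> c <= avg f -> exists x, c <= f x.
Proof.
move=> T0 cf; apply: contrapT => /forallNP nf.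
suff : avg f < c by rewrite ltNge cf.
rewrite /avg ltr_pdivrMr ?ltr0n//.
rewrite mulr_natr -sumr_const; case/card_gt0P: T0 => x0 _.
apply: ltr_sum => [|x _]; first by apply/hasP; exists x0; rewrite ?mem_index_enum.
by rewrite ltNge; apply/negP/nf.
Qed.

Lemma ltr_avg_exists (T : finType) (f : T -> R) c :
  (0 < #|T|)%N -> c < avg f -> exists x, c < f x.
Proof.
move=> T0 cf; apply: contrapT => /forallNP nf.
suff : avg f <= c by rewrite leNgt cf.
rewrite -(avg_cst c T0); apply: le_avg => x.
by rewrite leNgt; apply/negP/nf.
Qed.

Definition dens (T : finType) (A : pred T) : R := avg (fun x => (A x)%:R).

Lemma dens_ge0 (T : finType) (A : pred T) : 0 <= dens A.
Proof. by apply: avg_ge0 => x; rewrite ler0n. Qed.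

Lemma dens_le1 (T : finType) (A : pred T) : dens A <= 1.
Proof.
rewrite /dens/avg; have [->|T0] := posnP #|T|; first by rewrite invr0 mulr0.
rewrite ler_pdivrMr ?ltr0n// mul1r -sumr_const; apply: ler_sum => x _.
by rewrite lern1 leq_b1.
Qed.

Lemma le_dens (T : finType) (A B : pred T) :
  (forall x, A x -> B x) -> dens A <= dens B.
Proof.
by move=> AB; apply: le_avg => x; rewrite ler_nat; case: (A x) (AB x) => // ->.
Qed.

Lemma dens_lt0 (T : finType) (A : pred T) c : 0 < c -> c <= dens A ->
  exists x, A x.
Proof.
move=> c0 cA; apply: contrapT => /forallNP nA.
suff : dens A <= 0 by rewrite leNgt (lt_le_trans c0 cA).
rewrite /dens/avg big1 ?mul0r// => x _.
by case: (A x) (nA x).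
Qed.

(** [f] is at most [1] where it reaches [c] and below [c] elsewhere, so its average is at most the
    density of the first set plus [c]. *)
Lemma reverse_markov (T : finType) (f : T -> R) c :
  (0 < #|T|)%N -> 0 <= c -> (forall x, f x <= 1) -> 2 * c <= avg f ->
  c <= dens (fun x => c <= f x).
Proof.
move=> T0 c0 f1 cf.
suff : avg f <= dens (fun x => c <= f x) + c by lra.
rewrite -[X in _ + X](avg_cst c T0) -avgD; apply: le_avg => x.
have [_|/ltW fxc] /= := leP c (f x); last by rewrite add0r.
by rewrite -[leLHS]addr0 lerD ?f1.
Qed.

Lemma dens_pigeonhole (T L : finType) (A : pred T) (Q : L -> pred T) c :
  (0 < c) -> (forall x, A x -> exists l, Q l x) -> c <= dens A ->
  exists l, c / #|L|%:R <= dens (Q l).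
Proof.
move=> c0 AQ cA; apply: contrapT => /forallNP nQ.
suff /(le_lt_trans cA) : dens A < c by rewrite ltxx.
have [x Ax] := dens_lt0 c0 cA; have [l0 _] := AQ x Ax.
have L0 : (0 < #|L|)%N by apply/card_gt0P; exists l0.
apply: (@le_lt_trans _ _ (\sum_l dens (Q l))).
  rewrite -avg_sum; apply: le_avg => y.
  case Ay: (A y); last by rewrite sumr_ge0.
  have [l Ql] := AQ y Ay.
  by rewrite (bigD1 l)//= Ql lerDl sumr_ge0.
have -> : c = \sum_(l : L) c / #|L|%:R.
  by rewrite sumr_const -(mulr_natr (_ / _)) divfK// pnatr_eq0 -lt0n.
apply: ltr_sum; first by apply/hasP; exists l0; rewrite ?mem_index_enum.
by move=> l _; rewrite ltNge; apply/negP/nQ.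
Qed.

End average.

(** * Words, lines and the Hales-Jewett theorem *)

Definition wcat (I J : finType) (K : Type) (x : {ffun I -> K})
    (y : {ffun J -> K}) : {ffun I + J -> K} :=
  [ffun i => match i with inl i => x i | inr j => y j end].

Definition wmap (I : finType) (K K' : Type) (f : K -> K') (x : {ffun I -> K}) :
  {ffun I -> K'} := [ffun i => f (x i)].

(* A combinatorial line in [K^I] is a word over [option K] in which the
   wildcard [None] occurs. *)
Definition is_line (I : finType) (K : eqType) (L : {ffun I -> option K}) :=
  [exists i, L i == None].

Definition fill (I : finType) (K : Type) (L : {ffun I -> option K}) (a : K) :
  {ffun I -> K} := [ffun i => odflt a (L i)].

(* A [D]-dimensional subspace of [K^I] assigns to each coordinate either a
   letter or one of the wildcards [d : D], each of which has to occur. *)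
Definition is_sub (I D : finType) (K : eqType) (W : {ffun I -> K + D}) :=
  [forall d, [exists i, W i == inr d]].

Definition sub_eval (I D : finType) (K : Type) (W : {ffun I -> K + D})
    (v : {ffun D -> K}) : {ffun I -> K} :=
  [ffun i => match W i with inl a => a | inr d => v d end].

Lemma wcat_eta (I J : finType) (K : Type) (w : {ffun I + J -> K}) :
  wcat [ffun i => w (inl i)] [ffun j => w (inr j)] = w.
Proof. by apply/ffunP => -[i|j]; rewrite !ffunE. Qed.

Lemma wcat_bij (I J : finType) (K : Type) :
  bijective (fun p : {ffun I -> K} * {ffun J -> K} => wcat p.1 p.2).
Proof.
exists (fun w : {ffun I + J -> K} =>
  ([ffun i => w (inl i)] : {ffun I -> K}, [ffun j => w (inr j)] : {ffun J -> K})).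
  by move=> [x y]; congr pair; apply/ffunP => i; rewrite !ffunE.
exact: wcat_eta.
Qed.

Lemma fill_wcat (I J : finType) (K : Type) (L : {ffun I -> option K})
    (M : {ffun J -> option K}) a :
  fill (wcat L M) a = wcat (fill L a) (fill M a).
Proof. by apply/ffunP => -[i|j]; rewrite !ffunE. Qed.

Lemma fill_some (I : finType) (K : Type) (x : {ffun I -> K}) a :
  fill (wmap Some x) a = x.
Proof. by apply/ffunP => i; rewrite !ffunE. Qed.

Lemma fill_map (I : finType) (K K' : Type) (f : K -> K')
    (L : {ffun I -> option K}) a :
  fill (wmap (omap f) L) (f a) = wmap f (fill L a).
Proof. by apply/ffunP => i; rewrite !ffunE; case: (L i). Qed.

Lemma is_line_wcatl (I J : finType) (K : eqType) (L : {ffun I -> option K})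
    (M : {ffun J -> option K}) : is_line L -> is_line (wcat L M).
Proof. by move=> /existsP[i Li]; apply/existsP; exists (inl i); rewrite ffunE. Qed.

Lemma is_line_wcatr (I J : finType) (K : eqType) (L : {ffun I -> option K})
    (M : {ffun J -> option K}) : is_line M -> is_line (wcat L M).
Proof. by move=> /existsP[i Li]; apply/existsP; exists (inr i); rewrite ffunE. Qed.

Lemma is_line_map (I : finType) (K K' : eqType) (f : K -> K')
    (L : {ffun I -> option K}) : is_line (wmap (omap f) L) = is_line L.
Proof. by apply: eq_existsb => i; rewrite ffunE; case: (L i). Qed.

(** * The colouring Hales-Jewett theorem *)

Section hales_jewett.

Definition HJ (K C : finType) := exists I : finType,
  forall chi : {ffun I -> K} -> C, exists2 L : {ffun I -> option K},
    is_line L & forall a b, chi (fill L a) = chi (fill L b).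

Lemma HJ_surj (K K' C : finType) (h : K -> K') (g : K' -> K) :
  cancel g h -> HJ K C -> HJ K' C.
Proof.
move=> gh [I HI]; exists I => chi.
have [L lL chiL] := HI (chi \o wmap h).
exists (wmap (omap h) L); first by rewrite is_line_map.
by move=> a b; rewrite -(gh a) -(gh b) !fill_map; exact: chiL.
Qed.

Lemma HJ_subsingleton (K C : finType) : (forall a b : K, a = b) -> HJ K C.
Proof.
move=> K1; exists unit => chi; exists [ffun=> None].
  by apply/existsP; exists tt; rewrite ffunE.
by move=> a b; rewrite (K1 a b).
Qed.

(* Colour focusing: in the second alternative, [n] lines with pairwise distinct
   colours away from [None] all pass through [z] at [None]. *)
Lemma color_focusing (K C : finType) : (forall C' : finType, HJ K C') ->
  (0 < #|K|)%N -> forall n, exists I : finType,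
  forall chi : {ffun I -> option K} -> C,
    (exists2 L : {ffun I -> option (option K)},
       is_line L & forall a b, chi (fill L a) = chi (fill L b)) \/
    (exists z (S : {set C}), #|S| = n /\ forall c, c \in S ->
       exists L : {ffun I -> option (option K)}, [/\ is_line L,
         fill L None = z & forall a, chi (fill L (Some a)) = c]).
Proof.
move=> HK /card_gt0P[a0 _]; elim=> [|n [I IHI]].
  exists unit => chi; right; exists [ffun=> None], finset.set0.
  by split; [rewrite cards0|move=> c; rewrite inE].
(* Each word over [J] is coloured by the whole colouring of its fibre over [I]; along [M] this fibre
   colouring stays the same. *)
have [J HJ] := HK {ffun {ffun I -> option K} -> C}.
exists (I + J)%type => chi.
have [M lM HM] := HJ (fun y => [ffun x => chi (wcat x (wmap Some y))]).
pose M' := wmap (omap Some) M; have lM' : is_line M' by rewrite is_line_map.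
pose chi0 x := chi (wcat x (wmap Some (fill M a0))).
have chiE x a : chi (wcat x (fill M' (Some a))) = chi0 x.
  by have /ffunP/(_ x) := HM a a0; rewrite !ffunE fill_map.
have lift_mono L : is_line L -> (forall a b, chi0 (fill L a) = chi0 (fill L b)) ->
    exists2 L : {ffun I + J -> option (option K)},
      is_line L & forall a b, chi (fill L a) = chi (fill L b).
  move=> lL HL; exists (wcat L (wmap Some (wmap Some (fill M a0)))).
    exact: is_line_wcatl.
  by move=> a b; rewrite !fill_wcat !fill_some; exact: HL.
have [[L lL HL]|[z [S [Sn HS]]]] := IHI chi0; first by left; exact: lift_mono lL HL.
(* A focus whose colour is already in [S] completes the line of that colour. *)
have [zS|zS] := boolP (chi0 z \in S).
  left; have [L [lL Lz Lc]] := HS _ zS; apply: lift_mono lL _.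
  suff E a : chi0 (fill L a) = chi0 z by move=> a b; rewrite !E.
  by case: a => [a|]; rewrite ?Lz ?Lc.
(* Otherwise the focus moves to the [None] point of [M']: old lines run jointly with [M'], and [z]
   followed by [M'] is a new line of colour [chi0 z]. *)
right; exists (wcat z (fill M' None)), (chi0 z |: S)%SET.
split=> [|c]; first by rewrite cardsU1 zS Sn.
rewrite !inE => /predU1P[->|/HS[L [lL Lz Lc]]].
  exists (wcat (wmap Some z) M'); split; first exact: is_line_wcatr.
    by rewrite fill_wcat fill_some.
  by move=> a; rewrite fill_wcat fill_some chiE.
exists (wcat L M'); split; first exact: is_line_wcatl.
  by rewrite fill_wcat Lz.
by move=> a; rewrite fill_wcat chiE Lc.
Qed.

Lemma HJ_option (K : finType) :
  (forall C, HJ K C) -> forall C, HJ (option K) C.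
Proof.
move=> HK C; have [/card0_eq K0|K0] := posnP #|K|.
  by apply: HJ_subsingleton => -[a|] [b|] //; [have := K0 a|have := K0 a|have := K0 b].
have [I HI] := @color_focusing K C HK K0 #|C|.+1.
exists I => chi; have [//|[z [S [Sn _]]]] := HI chi.
by have := max_card (mem S); rewrite Sn ltnn.
Qed.

Lemma unlift_maxK n :
  cancel (unlift (@ord_max n)) (fun o => odflt ord_max (omap (lift ord_max) o)).
Proof. by move=> i; case: unliftP => [j ->|->]. Qed.

Theorem hales_jewett (K C : finType) : HJ K C.
Proof.
suff HI n C' : HJ 'I_n C'.
  by exact: HJ_surj (@enum_rankK K) (HI _ C).
elim: n C' => [|n IHn] C'; first by apply: HJ_subsingleton => -[].
by apply: HJ_surj (@unlift_maxK n) _; exact: HJ_option.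
Qed.

(** A letter of [K^D] is spread over a block of [D] coordinates, so a line over the alphabet [K^D]
    becomes a subspace over [K]. *)
Theorem multidim_hales_jewett (K C D : finType) : exists I : finType,
  forall chi : {ffun I -> K} -> C, exists2 W : {ffun I -> K + D},
    is_sub W & forall v v', chi (sub_eval W v) = chi (sub_eval W v').
Proof.
have [I HI] := hales_jewett {ffun D -> K} C.
exists (I * D)%type => chi.
have [L lL HL] := HI (fun x => chi [ffun p => x p.1 p.2]).
pose W : {ffun I * D -> K + D} :=
  [ffun p => if L p.1 is Some w then inl (w p.2) else inr p.2].
exists W.
  apply/forallP => d; move/existsP: lL => [i /eqP Li].
  by apply/existsP; exists (i, d); rewrite ffunE /= Li.
have WE v : sub_eval W v = [ffun p => fill L v p.1 p.2].
  by apply/ffunP => -[i d]; rewrite !ffunE /=; case: (L i).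
by move=> v v'; rewrite !WE; exact: HL.
Qed.

End hales_jewett.

(** Induction on cardinality; invariance under bijections lets alphabets and sets of wildcards be
    arbitrary finite types. *)
Lemma finType_ind (P : finType -> Prop) :
  P 'I_0 -> (forall D, P D -> P (option D)) ->
  (forall (D D' : finType) (f : D -> D') (g : D' -> D),
     cancel f g -> cancel g f -> P D -> P D') ->
  forall D, P D.
Proof.
move=> P0 PS Pb D; apply: (Pb _ _ _ _ enum_valK enum_rankK).
elim: {D}#|_| => // n IHn.
apply: (Pb _ _ _ _ _ (@unlift_maxK n) (PS _ IHn)) => -[j|] /=.
  by rewrite liftK.
by rewrite unlift_none.
Qed.

Lemma card_words_gt0 (I K : finType) : (0 < #|K|)%N -> (0 < #|{ffun I -> K}|)%N.
Proof. by move=> K0; rewrite card_ffun expn_gt0 K0. Qed.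

(** * Calculus of combinatorial subspaces *)

Section subspaces.

Definition sub_comp (I D E : finType) (K : Type) (W : {ffun I -> K + D})
    (V : {ffun D -> K + E}) : {ffun I -> K + E} :=
  [ffun i => match W i with inl a => inl a | inr d => V d end].

Lemma sub_evalE (I D E : finType) (K : Type) (W : {ffun I -> K + D})
    (V : {ffun D -> K + E}) v :
  sub_eval (sub_comp W V) v = sub_eval W (sub_eval V v).
Proof. by apply/ffunP => i; rewrite !ffunE; case: (W i) => // d; rewrite ffunE. Qed.

Lemma is_sub_comp (I D E : finType) (K : eqType) (W : {ffun I -> K + D})
    (V : {ffun D -> K + E}) : is_sub W -> is_sub V -> is_sub (sub_comp W V).
Proof.
move=> /forallP sW /forallP sV; apply/forallP => e.
have /existsP[d /eqP Vd] := sV e; have /existsP[i /eqP Wi] := sW d.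
by apply/existsP; exists i; rewrite ffunE Wi Vd.
Qed.

Lemma sub_eval_inj (I D : finType) (K : eqType) (W : {ffun I -> K + D}) :
  is_sub W -> injective (sub_eval W).
Proof.
move=> /forallP sW v v' /ffunP vv'; apply/ffunP => d.
by have /existsP[i /eqP Wi] := sW d; have := vv' i; rewrite !ffunE Wi.
Qed.

Lemma is_sub_inr (D D' : finType) (K : eqType) (f : D -> D') (g : D' -> D) :
  cancel g f -> is_sub [ffun d => inr (f d) : K + D'].
Proof.
by move=> gf; apply/forallP => d; apply/existsP; exists (g d); rewrite ffunE gf.
Qed.

Lemma is_sub_wcatl (I J D : finType) (K : eqType) (W : {ffun I -> K + D})
    (V : {ffun J -> K + D}) : is_sub W -> is_sub (wcat W V).
Proof.
move=> /forallP sW; apply/forallP => d; have /existsP[i Wi] := sW d.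
by apply/existsP; exists (inl i); rewrite ffunE.
Qed.

Lemma is_sub_wcatr (I J D : finType) (K : eqType) (W : {ffun I -> K + D})
    (V : {ffun J -> K + D}) : is_sub V -> is_sub (wcat W V).
Proof.
move=> /forallP sW; apply/forallP => d; have /existsP[i Wi] := sW d.
by apply/existsP; exists (inr i); rewrite ffunE.
Qed.

Lemma sub_eval_wcat (I J D : finType) (K : Type) (W : {ffun I -> K + D})
    (V : {ffun J -> K + D}) v :
  sub_eval (wcat W V) v = wcat (sub_eval W v) (sub_eval V v).
Proof. by apply/ffunP => -[i|i]; rewrite !ffunE. Qed.

Lemma sub_eval_inl (I D : finType) (K : Type) (x : {ffun I -> K})
    (v : {ffun D -> K}) : sub_eval (wmap inl x) v = x.
Proof. by apply/ffunP => i; rewrite !ffunE. Qed.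

Lemma is_line_sub_eval (I D : finType) (K : eqType)
    (W : {ffun I -> option K + D}) (v : {ffun D -> option K}) :
  is_sub W -> is_line v -> is_line (sub_eval W v).
Proof.
move=> /forallP sW /existsP[d vd]; have /existsP[i /eqP Wi] := sW d.
by apply/existsP; exists i; rewrite ffunE Wi.
Qed.

(** Lets [W] act on lines: [sub_eval (sub_some W) L] is the image of the line [L], its wildcard
    passed on. *)
Definition sub_some (I D : finType) (K : Type) (W : {ffun I -> K + D}) :
    {ffun I -> option K + D} :=
  wmap (fun c => match c with inl a => inl (Some a) | inr d => inr d end) W.

Lemma is_sub_some (I D : finType) (K : eqType) (W : {ffun I -> K + D}) :
  is_sub W -> is_sub (sub_some W).
Proof.
move=> /forallP sW; apply/forallP => d; have /existsP[i /eqP Wi] := sW d.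
by apply/existsP; exists i; rewrite ffunE Wi.
Qed.

Lemma fill_sub_some (I D : finType) (K : Type) (W : {ffun I -> K + D}) L a :
  fill (sub_eval (sub_some W) L) a = sub_eval W (fill L a).
Proof. by apply/ffunP => i; rewrite !ffunE; case: (W i) => // d; rewrite ffunE. Qed.

Lemma fill_sub_eval (I D : finType) (K : Type) (W : {ffun I -> option K + D}) v a :
  fill (sub_eval W (wmap Some (fill v a))) a = fill (sub_eval W v) a.
Proof. by apply/ffunP => i; rewrite !ffunE; case: (W i) => // d; rewrite !ffunE. Qed.

End subspaces.

(* A weak form of the Graham-Rothschild theorem for lines of [K^J], that is for
   words over [option K] in which [None] occurs. *)
Lemma line_dichotomy (K D M : finType) : exists J : finType,
  forall good : pred {ffun J -> option K},
    (exists2 W : {ffun J -> K + D}, is_sub W &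
       forall L, is_line L -> ~~ good (sub_eval (sub_some W) L)) \/
    (exists2 U : {ffun J -> option K + M}, is_sub U &
       forall t, is_line (sub_eval U t) && good (sub_eval U t)).
Proof.
move: D M; apply: finType_ind => [M|D IHD M|D D' f g fg gf IHD M].
- have [J _] := multidim_hales_jewett K void M; exists 'I_0 => good; left.
  exists [ffun i => inr i]; first by apply/forallP => -[].
  by move=> L /existsP[[]].
- have [M2 HM2] := multidim_hales_jewett (option K) (option K) M.
  have [M1 HM1] := IHD M2.
  have [N HN] := multidim_hales_jewett (option K) bool (M1 + M)%type.
  exists (unit + N)%type => good.
  pose one (T : Type) (x : T) : {ffun unit -> T} := [ffun=> x].
  (* A word starting with the wildcard is a line whatever follows; on [U] all such words are good or
     all are bad. *)
  have [U sU HU] := HN (fun t => good (wcat (one _ None) t)).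
  have [goodU|badU] := boolP (good (wcat (one _ None) (sub_eval U [ffun=> None]))).
    pose V : {ffun M1 + M -> option K + M} :=
      wcat [ffun=> inl None] [ffun m => inr m].
    have sV : is_sub V by apply: is_sub_wcatr; exact: (@is_sub_inr _ _ _ id id).
    right; exists (wcat (one _ (inl None)) (sub_comp U V)).
      by apply: is_sub_wcatr; exact: is_sub_comp.
    move=> t; rewrite sub_eval_wcat sub_evalE.
    rewrite (_ : sub_eval (one _ (inl None)) t = one _ None); last first.
      by apply/ffunP => i; rewrite !ffunE.
    rewrite (HU _ [ffun=> None]) goodU andbT; apply: is_line_wcatl.
    by apply/existsP; exists tt; rewrite ffunE.
  have [U1 sU1 HU1] : exists2 U1 : {ffun N -> option K + M1}, is_sub U1 &
      forall v, ~~ good (wcat (one _ None) (sub_eval U1 v)).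
    pose V : {ffun M1 + M -> option K + M1} :=
      wcat [ffun m => inr m] [ffun=> inl None].
    exists (sub_comp U V).
      apply: is_sub_comp => //.
      by apply: is_sub_wcatl; exact: (@is_sub_inr _ _ _ id id).
    by move=> v; rewrite sub_evalE (HU _ [ffun=> None]).
  (* The new wildcard is to occupy the first coordinate and those where [U1] is constantly [None];
     [Ua a] gives it the value [a]. Where it stays free, [HU1] excludes good lines. *)
  pose Ua (a : K) : {ffun N -> option K + M1} :=
    wmap (fun c => match c with inl o => inl (Some (odflt a o)) | inr m => inr m end) U1.
  have sUa a : is_sub (Ua a).
    apply/forallP => d; have /existsP[i /eqP Wi] := forallP sU1 d.
    by apply/existsP; exists i; rewrite ffunE Wi.
  pose ga a v := good (wcat (one _ (Some a)) (sub_eval (Ua a) v)).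
  have [[W sW HW]|[U2 sU2 HU2]] := HM1 (fun v => [exists a, ga a v]).
    left; pose W1 : {ffun N -> K + option D} := [ffun j => match U1 j with
      | inl None => inr None | inl (Some a) => inl a
      | inr m => match W m with inl a => inl a | inr d => inr (Some d) end end].
    exists (wcat (one _ (inr None)) W1).
      apply/forallP => -[d|]; last by apply/existsP; exists (inl tt); rewrite !ffunE.
      have /existsP[m /eqP Wm] := forallP sW d.
      have /existsP[i /eqP Ui] := forallP sU1 m.
      by apply/existsP; exists (inr i); rewrite !ffunE Ui Wm.
    move=> L lL; pose L' : {ffun D -> option K} := [ffun d => L (Some d)].
    case LN: (L None) => [a|].
      have lL' : is_line L'.
        move/existsP: lL => [[d|]]; last by rewrite LN.
        by move=> Ld; apply/existsP; exists d; rewrite ffunE.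
      have := HW _ lL'; rewrite negb_exists => /forallP/(_ a); congr (~~ good _).
      apply/ffunP => -[[]|j]; rewrite !ffunE /= ?LN //.
      case: (U1 j) => [[b|]|m] //=; rewrite ?LN //.
      by rewrite !ffunE; case: (W m) => [b|d] //=; rewrite ffunE.
    have := HU1 (sub_eval (sub_some W) L'); congr (~~ good _).
    apply/ffunP => -[[]|j]; rewrite !ffunE /= ?LN //.
    case: (U1 j) => [[b|]|m] //=; rewrite ?LN //.
    by rewrite !ffunE; case: (W m) => [b|d] //=; rewrite ffunE.
  (* Colouring each word by a letter [a] that makes it good yields [U3], on which one letter serves
     for all words. *)
  have [U3 sU3 HU3] := HM2 (fun t => [pick a | ga a (sub_eval U2 t)]).
  have /andP[_ /existsP[a0 ga0]] := HU2 (sub_eval U3 [ffun=> None]).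
  case: (pickP (fun a => ga a (sub_eval U2 (sub_eval U3 [ffun=> None]))))
    (HU3 [ffun=> None]); last first.
    by move=> /(_ a0); rewrite ga0.
  move=> a ga_a HU3a; right.
  exists (wcat (one _ (inl (Some a))) (sub_comp (Ua a) (sub_comp U2 U3))).
    by apply: is_sub_wcatr; do 2 apply: is_sub_comp => //.
  move=> t; rewrite sub_eval_wcat !sub_evalE.
  rewrite (_ : sub_eval (one _ (inl (Some a))) t = one _ (Some a)); last first.
    by apply/ffunP => i; rewrite !ffunE.
  have /andP[lt _] := HU2 (sub_eval U3 t).
  apply/andP; split; first by apply: is_line_wcatr; exact: is_line_sub_eval.
  by case: pickP (HU3a t) => // b gb [->].
have [J HJ] := IHD M; exists J => good.
have [[W sW HW]|HU] := HJ good; [left|by right].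
exists (sub_comp W [ffun d => inr (f d)]).
  by apply: is_sub_comp => //; exact: is_sub_inr gf.
move=> L lL.
have lL' : is_line (sub_eval [ffun d => inr (f d)] L : {ffun D -> option K}).
  by apply: is_line_sub_eval => //; exact: is_sub_inr gf.
have := HW _ lL'; congr (~~ good _).
apply/ffunP => j; rewrite !ffunE; case: (W j) => [b|d] //=.
by rewrite !ffunE.
Qed.

(** * Insensitive sets *)

Section density.
Variable R : realType.

Lemma avg_pair (S T : finType) (f : S * T -> R) :
  avg f = avg (fun x => avg (fun y => f (x, y))).
Proof.
rewrite /avg -mulr_suml -mulrA -invfM -natrM mulnC card_prod; congr (_ / _).
by rewrite pair_big; apply: eq_bigr => -[].
Qed.

Lemma avg_wcat (I J K : finType) (f : {ffun I + J -> K} -> R) :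
  avg f = avg (fun x : {ffun I -> K} => avg (fun y : {ffun J -> K} => f (wcat x y))).
Proof. by rewrite (avg_bij f (wcat_bij I J K)) avg_pair. Qed.

Definition DHJ (K : finType) (delta : R) := exists I : finType,
  forall A : pred {ffun I -> K}, delta <= dens R A ->
  exists2 L, is_line L & forall a, A (fill L a).

Definition MDHJ (K D : finType) (delta : R) := exists I : finType,
  forall A : pred {ffun I -> K}, delta <= dens R A ->
  exists2 W : {ffun I -> K + D}, is_sub W & forall v, A (sub_eval W v).

(** Induction on the dimension: many prefixes have a fibre dense enough to contain a line, by
    pigeonhole one line serves a positive proportion of them, and these prefixes contain a subspace.
    The line supplies the extra wildcard. *)
Lemma multidim_DHJ (K : finType) : (0 < #|K|)%N ->
  (forall delta, 0 < delta -> DHJ K delta) ->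
  forall (D : finType) delta, 0 < delta -> MDHJ K D delta.
Proof.
move=> K0 HK; apply: finType_ind => [delta d0|D IHD delta d0|D D' f g fg gf IHD delta d0].
- exists unit => A /(dens_lt0 d0)[x Ax]; exists (wmap inl x).
    by apply/forallP => -[].
  by move=> v; rewrite sub_eval_inl.
- have [J HJ] := HK (delta / 2) ltac:(lra).
  have L0 : (0 < #|{ffun J -> option K}|)%N.
    by rewrite card_words_gt0 // card_option.
  have [I HI] := IHD (delta / 2 / #|{ffun J -> option K}|%:R)
    ltac:(rewrite !divr_gt0// ltr0n//).
  exists (I + J)%type => A; rewrite /dens avg_wcat => dA.
  pose Q L (x : {ffun I -> K}) := is_line L && [forall a, A (wcat x (fill L a))].
  have [||L] := @dens_pigeonhole R _ {ffun J -> option K}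
      (fun x => delta / 2 <= dens R (fun y => A (wcat x y))) Q (delta / 2) ltac:(lra).
  + by move=> x /HJ[L lL AL]; exists L; rewrite /Q lL /=; exact/forallP.
  + apply: reverse_markov; rewrite ?card_words_gt0 //; [lra| |].
      by move=> x; exact: dens_le1.
    by rewrite mulrC divfK ?pnatr_eq0.
  move=> /[dup] /(dens_lt0 _)[|x /andP[lL _]].
    by rewrite !divr_gt0// ltr0n.
  move=> /HI[W sW AW].
  pose W' : {ffun I -> K + option D} :=
    wmap (fun c => match c with inl a => inl a | inr d => inr (Some d) end) W.
  pose L' : {ffun J -> K + option D} :=
    wmap (fun c => if c is Some a then inl a else inr None) L.
  exists (wcat W' L').
    apply/forallP => -[d|].
      have /existsP[i /eqP Wi] := forallP sW d.
      by apply/existsP; exists (inl i); rewrite !ffunE Wi.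
    have /existsP[j /eqP Lj] := lL.
    by apply/existsP; exists (inr j); rewrite !ffunE Lj.
  move=> v; have /andP[_ /forallP/(_ (v None))] := AW [ffun d => v (Some d)].
  congr A; apply/ffunP => -[i|j]; rewrite !ffunE.
    by case: (W i) => // d; rewrite ffunE.
  by case: (L j).
have [I HI] := IHD _ d0; exists I => A /HI[W sW AW].
have sf := is_sub_inr K gf.
exists (sub_comp W [ffun d => inr (f d)]); first exact: is_sub_comp.
by move=> v; rewrite sub_evalE.
Qed.

Lemma bernoulli_unbounded (rho c : R) : 0 < rho -> exists t, c <= (1 + rho) ^+ t.
Proof.
move=> r0; exists (Num.bound `|c / rho|).
have : c / rho <= (Num.bound `|c / rho|)%:R.
  exact: le_trans (ler_norm _) (ltW (archi_boundP (normr_ge0 _))).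
rewrite ler_pdivrMr // => /le_trans -> //.
suff E n : n%:R * rho + 1 <= (1 + rho) ^+ n by apply: le_trans (E _); rewrite lerDl.
elim: n => [|n IHn]; first by rewrite mul0r add0r expr0.
rewrite exprS -natr1.
apply: (@le_trans _ _ ((1 + rho) * (n%:R * rho + 1))); last first.
  by rewrite ler_wpM2l // ; lra.
have : 0 <= rho * (n%:R * rho) by rewrite !mulr_ge0 // ltW.
lra.
Qed.

Section insensitive.
Variable K : finType.
Hypotheses (K0 : (0 < #|K|)%N) (HK : forall delta, 0 < delta -> DHJ K delta).

(* [E] does not distinguish the letters [None] and [Some a]. *)
Definition insens (I : finType) (a : K) (E : pred {ffun I -> option K}) :=
  forall w, E w = E (wmap Some (fill w a)).

Lemma insens_fill (I : finType) a (E : pred {ffun I -> option K}) w w' :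
  insens a E -> fill w a = fill w' a -> E w = E w'.
Proof. by move=> iE ww'; rewrite iE ww' -iE. Qed.

Lemma insens_sub (I D : finType) (W : {ffun I -> option K + D}) a E :
  insens a E -> insens a (fun v => E (sub_eval W v)).
Proof. by move=> iE v; apply: insens_fill iE _; rewrite fill_sub_eval. Qed.

Lemma words_gt0 (I : finType) : (0 < #|{ffun I -> option K}|)%N.
Proof. by rewrite card_words_gt0 // card_option. Qed.

(* [resample y u] redraws one letter other than [None] in each block of [y]:
   this preserves the uniform measure on words over [option K], and the new
   letters are uniform in [K^M], where the density theorem for [K] applies. *)
Section resampling.
Variables (M T : finType).
Implicit Types (y : {ffun M * T -> option K}) (u : {ffun M -> K}).

Definition slot y (m : M) := [pick t | y (m, t) != None].

Definition resample y u : {ffun M * T -> option K} :=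
  [ffun p => if slot y p.1 == Some p.2 then Some (u p.1) else y p].

Definition extract y u : {ffun M -> K} :=
  [ffun m => if slot y m is Some t then odflt (u m) (y (m, t)) else u m].

Lemma slot_resample y u : slot (resample y u) = slot y.
Proof.
apply/funext => m; apply: eq_pick => t; rewrite ffunE /=.
case: ifP => // /eqP; rewrite /slot; case: pickP => // s ys [<-].
by rewrite ys.
Qed.

(** Exchanging the redrawn letters with [u] is an involution of the pairs [(y, u)], since resampling
    does not move the slots; it preserves the uniform measure. *)
Lemma avg_resample (f : {ffun M * T -> option K} -> R) :
  avg (fun y => avg (fun u => f (resample y u))) = avg f.
Proof.
transitivity (avg (fun p : {ffun M * T -> option K} * {ffun M -> K} => f p.1)).
  pose h (p : {ffun M * T -> option K} * {ffun M -> K}) :=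
    (resample p.1 p.2, extract p.1 p.2).
  have hK : involutive h.
    move=> [y u]; rewrite /h /=; congr pair; apply/ffunP.
      move=> [m t]; rewrite !ffunE slot_resample /=; case: eqP => // ymt.
      rewrite ymt; move: ymt; rewrite /slot; case: pickP => // s ys [<-].
      by case: (y _) ys.
    move=> m; rewrite !ffunE slot_resample; case E: (slot y m) => [t|] //.
    by rewrite ffunE /= E eqxx.
  by rewrite (avg_bij (fun p => f p.1) (inv_bij hK)) avg_pair.
rewrite avg_pair; apply: eq_avg => y.
by rewrite /= avg_cst // card_words_gt0.
Qed.

(** Overwriting block [m], all of whose letters are [None], by an arbitrary word is injective on
    pairs, and there are at least [2 ^ #|T|] such words because [K] is nonempty. *)
Lemma dens_no_slot m :
  dens R (fun y => slot y m == None) <= (2 ^+ #|T|)^-1.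
Proof.
pose h (p : {ffun M * T -> option K} * {ffun T -> option K}) : {ffun M * T -> option K} :=
  [ffun q => if q.1 == m then p.2 q.2 else p.1 q].
pose B := finset.setX (finset (fun y => slot y m == None)) [set: {ffun T -> option K}]%SET.
have hB : {in B &, injective h}.
  move=> [y u] [y' u']; rewrite !inE !andbT /slot.
  case: pickP => // yN _; case: pickP => // y'N _ /ffunP hh.
  congr pair; apply/ffunP.
    move=> [m' t]; have := hh (m', t); rewrite !ffunE /=; case: eqP => // -> _.
    by have /negbFE/eqP -> := yN t; have /negbFE/eqP -> := y'N t.
  by move=> t; have := hh (m, t); rewrite !ffunE /= eqxx.
have := max_card (mem (h @: B)).
rewrite card_in_imset // cardsX cardsT => cB.
rewrite /dens /avg ler_pdivrMr ?ltr0n ?words_gt0 // mulrC ler_pdivlMr ?exprn_gt0 //.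
rewrite -natr_sum -natrX -natrM ler_nat; apply: leq_trans cB.
rewrite -big_mkcond sum1_card cardsE leq_mul //.
rewrite card_ffun card_option.
by have [->//|T0] := posnP #|T|; rewrite leq_exp2r.
Qed.

End resampling.

(** For some [y], the letters [u] whose resampled word lies in [E] are dense, and the
    multidimensional theorem over [K] gives a subspace of them. Insensitivity extends it from words
    over [K] to words over [option K]. *)
Lemma insensitive_sub (D : finType) (beta : R) : 0 < beta -> exists N : finType,
  forall a (E : pred {ffun N -> option K}), insens a E -> beta <= dens R E ->
  exists2 W : {ffun N -> option K + D}, is_sub W & forall v, E (sub_eval W v).
Proof.
move=> b0; have [M HM] := multidim_DHJ K0 HK D (delta := beta / 2) ltac:(lra).
(* Makes [#|M| / 2 ^ n] at most [beta / 2], which bounds the density of words having a block without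
   slot. *)
pose n := Num.bound (#|M|%:R / (beta / 2)).
exists (M * 'I_n)%type => a E iE bE.
pose good (y : {ffun M * 'I_n -> option K}) := [forall m, slot y m != None].
have : beta / 2 <= dens R (fun y => E y && good y).
  have : dens R E <= dens R (fun y => E y && good y) +
      \sum_m dens R (fun y : {ffun M * 'I_n -> option K} => slot y m == None).
    rewrite -avg_sum -avgD; apply: le_avg => y.
    case: (E y) => /=; last by rewrite add0r sumr_ge0.
    have [_|] := boolP (good y); first by rewrite lerDl sumr_ge0.
    rewrite negb_forall => /existsP[m]; rewrite negbK => ym.
    by rewrite add0r (bigD1 m) //= ym lerDl sumr_ge0.
  have : \sum_m dens R (fun y : {ffun M * 'I_n -> option K} => slot y m == None)
      <= beta / 2.
    apply: (@le_trans _ _ (\sum_(m : M) (2 ^+ n)^-1)).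
      by apply: ler_sum => m _; have := @dens_no_slot M 'I_n m; rewrite card_ord.
    rewrite sumr_const -(mulr_natl (_^-1)) ler_pdivrMr ?exprn_gt0 //.
    by rewrite mulrC -ler_pdivrMr ?divr_gt0 // ltW // upper_nthrootP.
  lra.
rewrite /dens -avg_resample => /(ler_avg_exists (words_gt0 _))[y].
move=> /[dup] /(dens_lt0 _)[|u /andP[_ gy]]; first by rewrite divr_gt0.
have {u}gy m : exists2 t, slot y m = Some t & y (m, t) != None.
  move/forallP: gy => /(_ m); rewrite slot_resample.
  by rewrite /slot; case: pickP => // t yt _; exists t.
move=> /HM[W sW HW].
exists [ffun p => if slot y p.1 == Some p.2
   then match W p.1 with inl b => inl (Some b) | inr d => inr d end else inl (y p)].
  apply/forallP => d; have /existsP[m /eqP Wm] := forallP sW d.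
  have [t ymt _] := gy m.
  by apply/existsP; exists (m, t); rewrite ffunE /= ymt eqxx Wm.
move=> v; have /andP[Ey _] := HW (fill v a).
rewrite (insens_fill (w' := resample y (sub_eval W (fill v a))) iE) //.
apply/ffunP => -[m t]; rewrite !ffunE /=; case: eqP => // _.
by case: (W m) => // d; rewrite ffunE.
Qed.

End insensitive.
End density.

(** * Tiling insensitive sets by subspaces *)

Section tiling.
Variables (R : realType) (K : finType).
Hypotheses (K0 : (0 < #|K|)%N) (HK : forall delta : R, 0 < delta -> DHJ K delta).

Section removal.
Variables (D M N : finType) (a : K) (E : pred {ffun M + N -> option K}).
Hypothesis iE : insens a E.

Definition tile (x : {ffun M -> option K}) : option {ffun N -> option K + D} :=
  [pick W | is_sub W && [forall v, E (wcat x (sub_eval W v))]].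

Definition tiled x y :=
  if tile x is Some W then [exists v, sub_eval W v == y] else false.

Lemma tiledW x y : tiled x y -> E (wcat x y).
Proof.
rewrite /tiled /tile; case: pickP => // W /andP[_ /forallP EW] /existsP[v /eqP <-].
exact: EW.
Qed.

Lemma insens_wcatl y : insens a (fun x => E (wcat x y)).
Proof. by move=> x; apply: insens_fill iE _; rewrite !fill_wcat fill_some. Qed.

Lemma insens_wcatr x : insens a (fun y => E (wcat x y)).
Proof. by move=> y; apply: insens_fill iE _; rewrite !fill_wcat fill_some. Qed.

(** [x] and [wmap Some (fill x a)] have the same fibre of [E], and [tile] depends on its argument
    through this fibre only. *)
Lemma insens_untiled y : insens a (fun x => E (wcat x y) && ~~ tiled x y).
Proof.
move=> x; rewrite -insens_wcatl; congr (_ && ~~ _); rewrite /tiled /tile.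
rewrite (@eq_pick _ _ (fun W : {ffun N -> option K + D} => is_sub W &&
  [forall v, E (wcat (wmap Some (fill x a)) (sub_eval W v))])) // => W.
by congr (_ && _); apply: eq_forallb => v; exact: insens_wcatl.
Qed.

Lemma sum_tiled x (f : {ffun N -> option K} -> R) W : tile x = Some W ->
  \sum_y (tiled x y)%:R * f y = \sum_v f (sub_eval W v).
Proof.
rewrite /tiled => xW.
have /andP[sW _] : is_sub W && [forall v, E (wcat x (sub_eval W v))].
  by move: xW; rewrite /tile; case: pickP => // ? ? [<-].
rewrite xW -big_imset /=; last by move=> v v' _ _; exact: sub_eval_inj.
rewrite [RHS]big_mkcond; apply: eq_bigr => y _.
have -> : (y \in sub_eval W @: {ffun D -> option K}) = [exists v, sub_eval W v == y].
  apply/imsetP/existsP => [[v _ ->]|[v /eqP <-]]; exists v => //.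
by case: ifP; rewrite ?mul1r ?mul0r.
Qed.

(** The tile at [x], preceded by the constant letters of [x], is a subspace inside [E], where the
    average of [f] is at most [0]. *)
Lemma avg_tiled_le0 (f : {ffun M + N -> option K} -> R) :
  (forall W : {ffun M + N -> option K + D}, is_sub W ->
     (forall v, E (sub_eval W v)) -> avg (fun v => f (sub_eval W v)) <= 0) ->
  avg (fun x => avg (fun y => (tiled x y)%:R * f (wcat x y))) <= 0.
Proof.
move=> f0; suff H x : avg (fun y => (tiled x y)%:R * f (wcat x y)) <= 0.
  rewrite -[leRHS](avg_cst 0 (words_gt0 K M)); exact: le_avg.
case xW : (tile x) => [W|]; last first.
  by rewrite /avg big1 ?mul0r // => y _; rewrite /tiled xW mul0r.
rewrite /avg (sum_tiled _ xW) pmulr_lle0 ?invr_gt0 ?ltr0n ?words_gt0 //.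
have : is_sub W && [forall v, E (wcat x (sub_eval W v))].
  by move: xW; rewrite /tile; case: pickP => // ? ? [<-].
move=> /andP[sW /forallP EW].
have := f0 (wcat (wmap inl x) W) (is_sub_wcatr _ sW).
rewrite /avg pmulr_lle0 ?invr_gt0 ?ltr0n ?words_gt0 // => f0W.
under eq_bigr => v _ do rewrite -{1}(sub_eval_inl x v) -sub_eval_wcat.
by apply: f0W => v; rewrite sub_eval_wcat sub_eval_inl.
Qed.

(** By [reverse_markov] a proportion at least [c] of the prefixes has a fibre of density at least
    [c]; each such fibre has a tile, with at least one point. *)
Lemma avg_tiled_ge (c : R) : 0 < c ->
  (forall E' : pred {ffun N -> option K}, insens a E' -> c <= dens R E' ->
   exists2 W : {ffun N -> option K + D}, is_sub W & forall v, E' (sub_eval W v)) ->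
  2 * c <= dens R E ->
  c / #|{ffun N -> option K}|%:R <= avg (fun x => dens R (tiled x)).
Proof.
move=> c0 HN; rewrite /dens avg_wcat => cE.
have := @reverse_markov _ _ (fun x => dens R (fun y => E (wcat x y))) c
  (words_gt0 K M) (ltW c0) (fun x => dens_le1 R _) cE.
rewrite -(ler_pM2r (x := #|{ffun N -> option K}|%:R^-1)) ?invr_gt0 ?ltr0n ?words_gt0 //.
move=> /le_trans; apply; rewrite mulrC -avgZ; apply: le_avg => x.
have [xc|_] := boolP (c <= dens R (fun y => E (wcat x y))); last first.
  by rewrite mulr0 dens_ge0.
rewrite mulr1; have [W sW EW] := HN _ (insens_wcatr x) xc.
case xW : (tile x) => [W'|]; last first.
  move: xW; rewrite /tile; case: pickP => // /(_ W).
  by rewrite sW => /negP[]; apply/forallP.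
rewrite [leRHS](_ : _ =
    (\sum_(v : {ffun D -> option K}) 1) / #|{ffun N -> option K}|%:R); last first.
  rewrite /avg -(sum_tiled (fun=> 1) xW); congr (_ / _).
  by apply: eq_bigr => y _; rewrite mulr1.
rewrite ler_peMl ?invr_ge0 // sumr_const.
by rewrite ler1n words_gt0.
Qed.

End removal.

(* In each round the tiles are removed from the fibres of [E] over an initial
   segment of the coordinates; what remains is insensitive in that segment and
   its density has dropped by the factor [1 / (1 + rho)]. *)
Lemma tiling_rounds (D : finType) (beta : R) : 0 < beta ->
  exists2 rho : R, 0 < rho & forall t, exists M : finType,
  forall a (E : pred {ffun M -> option K}) (f : {ffun M -> option K} -> R),
  insens a E -> (forall w, f w <= 1) ->
  (forall W : {ffun M -> option K + D}, is_sub W ->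
     (forall v, E (sub_eval W v)) -> avg (fun v => f (sub_eval W v)) <= 0) ->
  avg (fun w => (E w)%:R * f w) <= beta / 2 + (1 + rho)^-1 ^+ t * dens R E.
Proof.
move=> b0; have [N HN] := insensitive_sub K0 HK D (beta := beta / 4) ltac:(lra).
(* The density that one round of tiles covers at least, by [avg_tiled_ge] with [c = beta / 4]. *)
pose rho := beta / 4 / #|{ffun N -> option K}|%:R.
have rho0 : 0 < rho by rewrite !divr_gt0 // ltr0n words_gt0.
have q0 t : 0 <= (1 + rho)^-1 ^+ t :> R by rewrite exprn_ge0 // invr_ge0; lra.
exists rho => // t.
have trivial_bound (M : finType) (E : pred {ffun M -> option K}) f :
    (forall w, f w <= 1) -> avg (fun w => (E w)%:R * f w) <= dens R E.
  by move=> f1; apply: le_avg => w; rewrite ler_piMr.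
elim: t => [|t [M HM]].
  exists void => a E f iE f1 _; rewrite expr0 mul1r.
  by apply: le_trans (trivial_bound _ _ _ f1) _; rewrite lerDr ltW // divr_gt0.
exists (M + N)%type => a E f iE f1 fW.
have [Eb|bE] := ltP (dens R E) (beta / 2).
  apply: le_trans (trivial_bound _ _ _ f1) _.
  have := mulr_ge0 (q0 t.+1) (dens_ge0 R E); lra.
have Hge : rho <= avg (fun x => dens R (tiled D E x)).
  by apply: (avg_tiled_ge (a := a)) => //; [lra|exact: HN|lra].
have Hle := avg_tiled_le0 fW.
pose U y x := E (wcat x y) && ~~ tiled D E x y.
have Hsplit (g : {ffun M + N -> option K} -> R) : avg (fun w => (E w)%:R * g w) =
    avg (fun x => avg (fun y => (tiled D E x y)%:R * g (wcat x y))) +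
    avg (fun y => avg (fun x => (U y x)%:R * g (wcat x y))).
  rewrite (exchange_avg (fun y x => (U y x)%:R * g (wcat x y))) -avgD avg_wcat.
  apply: eq_avg => x; rewrite -avgD; apply: eq_avg => y; rewrite -mulrDl /U.
  case: (boolP (tiled D E x y)) => [/tiledW ->|_]; first by rewrite addr0.
  by rewrite andbT add0r.
have HU : avg (fun y => dens R (U y)) <= (1 + rho)^-1 * dens R E.
  have := Hsplit (fun _ => 1).
  have -> : avg (fun w => (E w)%:R * 1) = dens R E.
    by apply: eq_avg => w; rewrite mulr1.
  have -> : avg (fun x => avg (fun y => (tiled D E x y)%:R * 1)) =
      avg (fun x => dens R (tiled D E x)).
    by apply: eq_avg => x; apply: eq_avg => y; rewrite mulr1.
  have -> : avg (fun y => avg (fun x => (U y x)%:R * 1)) = avg (fun y => dens R (U y)).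
    by apply: eq_avg => x; apply: eq_avg => y; rewrite mulr1.
  move=> EE; rewrite mulrC ler_pdivlMr; last lra.
  have u0 : 0 <= avg (fun y => dens R (U y)) by apply: avg_ge0 => y; exact: dens_ge0.
  have u1 : avg (fun y => dens R (U y)) <= 1.
    by rewrite -(avg_cst 1 (words_gt0 K N)); apply: le_avg => y; exact: dens_le1.
  (* The untiled density is at most [1], so the tiled one, being at least [rho], is at least [rho]
     times it; together they make up the density of [E]. *)
  have := ler_pM u0 (ltW rho0) u1 (lexx rho); lra.
rewrite Hsplit -[leRHS]add0r lerD //.
apply: (@le_trans _ _ (avg (fun y => beta / 2 + (1 + rho)^-1 ^+ t * dens R (U y)))).
  apply: le_avg => y; apply: (HM a) => //; first exact: insens_untiled.
  move=> W sW UW.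
  have := fW (wcat W (wmap inl y)) (is_sub_wcatl _ sW).
  under eq_avg do rewrite sub_eval_wcat sub_eval_inl.
  by apply => v; rewrite sub_eval_wcat sub_eval_inl; have /andP[] := UW v.
rewrite avgD avg_cst ?words_gt0 // avgZ lerD2l exprSr -mulrA.
by rewrite ler_wpM2l.
Qed.

(** Enough rounds make the remainder negligible. Contrapositively, a function correlating with an
    insensitive set has a positive average on a subspace inside it. *)
Lemma tiling_single (D : finType) (beta : R) : 0 < beta -> exists M : finType,
  forall a (E : pred {ffun M -> option K}) (f : {ffun M -> option K} -> R),
  insens a E -> (forall w, f w <= 1) ->
  (forall W : {ffun M -> option K + D}, is_sub W ->
     (forall v, E (sub_eval W v)) -> avg (fun v => f (sub_eval W v)) <= 0) ->
  avg (fun w => (E w)%:R * f w) <= beta.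
Proof.
move=> b0; have [rho rho0 HM] := tiling_rounds D b0.
have [t tP] := bernoulli_unbounded (2 / beta) rho0.
have {}tP : (1 + rho)^-1 ^+ t <= beta / 2.
  by rewrite exprVn -(invf_div 2 beta) lef_pV2 ?posrE ?exprn_gt0 ?divr_gt0 //; lra.
have q0 : 0 <= (1 + rho)^-1 ^+ t :> R by rewrite exprn_ge0 // invr_ge0; lra.
have {HM}[M HM] := HM t; exists M => a E f iE f1 fW.
apply: le_trans (HM a E f iE f1 fW) _.
have := ler_pM q0 (dens_ge0 R E) tP (dens_le1 R E); lra.
Qed.

(** The sets are treated one at a time: first a subspace inside [E a] on which the correlation with
    the remaining sets persists, then the induction hypothesis within it. *)
Lemma tiling (s : seq K) : forall (D : finType) (beta : R), 0 < beta ->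
  exists M : finType,
  forall (E : K -> pred {ffun M -> option K}) (f : {ffun M -> option K} -> R),
  (forall a, insens a (E a)) -> (forall w, f w <= 1) ->
  beta < avg (fun w => (all (E^~ w) s)%:R * f w) ->
  exists2 W : {ffun M -> option K + D}, is_sub W & 0 < avg (fun v => f (sub_eval W v)).
Proof.
elim: s => [|a s IHs] D beta b0.
  exists D => E f _ _; under eq_avg do rewrite /= mul1r.
  move=> bf; exists [ffun d => inr d]; first exact: (@is_sub_inr _ _ _ id id).
  apply: lt_trans b0 _; apply: lt_le_trans bf _; rewrite le_eqVlt; apply/orP; left.
  by apply/eqP; apply: eq_avg => v; congr f; apply/ffunP => d; rewrite !ffunE.
have [D1 HD1] := IHs D (beta / 2) ltac:(lra).
have [M HM] := tiling_single D1 (beta := beta / 2) ltac:(lra).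
exists M => E f iE f1 bf.
(* Subtracting [beta / 2] turns a positive average of [g] on a subspace into the lower bound that
   the induction hypothesis requires. *)
pose g w := (all (E^~ w) s)%:R * f w - beta / 2.
have g1 w : g w <= 1.
  by rewrite /g; case: (all _ s) => /=; have := f1 w; lra.
have /(contra_not (HM a _ _ (iE a) g1))/existsNP[W] :
    ~ avg (fun w => (E a w)%:R * g w) <= beta / 2.
  apply/negP; rewrite -ltNge.
  have : avg (fun w => (all (E^~ w) (a :: s))%:R * f w) <=
     avg (fun w => (E a w)%:R * g w) + beta / 2.
    rewrite -[X in _ + X](avg_cst _ (words_gt0 K M)) -avgD; apply: le_avg => w /=.
    by rewrite /g; case: (E a w) => /=; lra.
  lra.
move=> /not_implyP[sW /not_implyP[_ /negP]]; rewrite -ltNge.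
rewrite avgB avg_cst ?words_gt0 // subr_gt0 => bW.
have [V sV fV] := HD1 (fun b v => E b (sub_eval W v)) (fun v => f (sub_eval W v))
  (fun b => insens_sub W (iE b)) (fun v => f1 _) bW.
exists (sub_comp W V); first exact: is_sub_comp.
by under eq_avg do rewrite sub_evalE.
Qed.

End tiling.

(** * The density Hales-Jewett theorem *)

Section density_hales_jewett.
Variable R : realType.

(* The cells [first_fail D a], for [a : K], partition the complement of the
   intersection of the [D b]; each is an intersection of sets [D b] and a
   complement of one, which keeps it insensitive. *)
Definition first_fail (K : finType) (D : pred K) (a b : K) : bool :=
  if b == a then ~~ D b else (enum_rank b < enum_rank a)%N ==> D b.

Lemma first_failE (K : finType) (D : pred K) :
  ((~~ [forall b, D b])%:R : R) = \sum_a [forall b, first_fail D a b]%:R.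
Proof.
have [/forallP allD|] := boolP [forall b, D b].
  rewrite big1 // => a _; case: forallP => // /(_ a).
  by rewrite /first_fail eqxx allD.
rewrite negb_forall => /existsP[c nDc].
case: (@arg_minnP _ c (fun b => ~~ D b) (fun b => enum_rank b) nDc) => a nDa mina.
rewrite (bigD1 a) //= big1 ?addr0.
  suff -> : [forall b, first_fail D a b] by [].
  apply/forallP => b; rewrite /first_fail; case: eqP => [->//|_].
  by apply/implyP; apply: contraLR => /mina; rewrite -leqNgt.
move=> a' a'a; case: forallP => // ff; exfalso.
have := ff a'; rewrite /first_fail eqxx => /mina; rewrite leq_eqVlt => /orP[/eqP|aa'].
  by move=> /val_inj/enum_rank_inj aa'; rewrite aa' eqxx in a'a.
have := ff a; rewrite /first_fail eq_sym (negbTE a'a) aa' /=.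
by rewrite (negbTE nDa).
Qed.

Lemma DHJ_le (K : finType) (d d' : R) : d <= d' -> DHJ K d -> DHJ K d'.
Proof. by move=> dd' [I HI]; exists I => A /(le_trans dd')/HI. Qed.

Lemma not_DHJ (K I : finType) (d : R) : ~ DHJ K d ->
  exists2 A : pred {ffun I -> K}, d <= dens R A &
    forall L, is_line L -> ~ forall a, A (fill L a).
Proof.
move=> nHK; apply: contrapT => nA; apply: nHK; exists I => A dA.
apply: contrapT => nL; apply: nA; exists A => // L lL AL.
by apply: nL; exists L.
Qed.

(** * The density increment: from [K] to [option K] *)

Section step.
Variable K : finType.
Hypotheses (K0 : (0 < #|K|)%N) (HK : forall delta : R, 0 < delta -> DHJ K delta).

(* [d] plays the role of the infimum of the densities for which the theorem
   holds for the alphabet [option K]. *)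
Lemma DHJ_critical (d : R) : 0 < d <= 2 ->
  (forall e, 0 < e -> DHJ (option K) (d + e)) ->
  (forall e, 0 < e -> ~ DHJ (option K) (d - e)) -> False.
Proof.
move=> /andP[d0 d2] Hpos Hneg.
have [J0 HJ0] := HK (delta := d / 4) ltac:(lra).
have L0 : (0 < #|{ffun J0 -> option K}|)%N := words_gt0 K J0.
pose theta := d / 4 / #|{ffun J0 -> option K}|%:R.
have th0 : 0 < theta by rewrite !divr_gt0 // ltr0n.
have th1 : theta <= 1.
  by rewrite ler_pdivrMr ?ltr0n // mul1r (@le_trans _ _ 1) ?ler1n //; lra.
pose gam := d * theta / 4.
have g0 : 0 < gam by rewrite divr_gt0 // mulr_gt0.
have gd : gam <= d / 2 by have := ler_wpM2l (ltW d0) th1; rewrite /gam; lra.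
have [D HD] := Hpos _ g0.
have b0 : 0 < gam / (#|K|%:R + 1) by rewrite divr_gt0 // ltr_wpDl.
have [M HM] := tiling K0 HK (enum K) D b0.
have [J HJ] := line_dichotomy K J0 M.
pose q : R := #|{ffun J -> option K}|%:R.
have q1 : 1 <= q by rewrite ler1n words_gt0.
(* So small that a fibre of density below [d - gam] could not be compensated by the other [q - 1],
   all below [d + eps]. *)
pose eps := gam / (2 * q).
have e0 : 0 < eps by rewrite divr_gt0 // ; lra.
have [N HN] := Hpos _ e0.
have [A dA lfA] := not_DHJ (J + N)%type (Hneg _ e0).
pose p y := dens R (fun x => A (wcat y x)).
have p_lt y : p y < d + eps.
  rewrite ltNge; apply/negP => /HN[L lL AL].
  apply: (lfA (wcat (wmap Some y) L)); first exact: is_line_wcatr.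
  by move=> a; rewrite fill_wcat fill_some.
have p_ge y : d - gam <= p y.
  have : \sum_y p y >= q * (d - eps).
    move: dA; rewrite /dens avg_wcat {1}/avg ler_pdivlMr ?ltr0n ?words_gt0 //.
    by rewrite mulrC.
  rewrite (bigD1 y) //=.
  have : \sum_(z | z != y) p z <= (q - 1) * (d + eps).
    apply: (@le_trans _ _ (\sum_(z | z != y) (d + eps))).
      by apply: ler_sum => z _; exact: ltW.
    have : \sum_(z : {ffun J -> option K}) (d + eps) = q * (d + eps).
      by rewrite sumr_const -(mulr_natl (_ + _)).
    by rewrite (bigD1 y) //=; lra.
  have : eps * (2 * q) = gam by rewrite /eps divfK // gt_eqF //; lra.
  lra.
pose good (L : {ffun J -> option K}) :=
  theta <= dens R (fun x => [forall a, A (wcat (wmap Some (fill L a)) x)]).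
(* A subspace without good lines is impossible: its fibres have density at least [d / 2], so for
   many [x] the theorem over [K] gives a line, and by pigeonhole one line serves a proportion
   [theta] of the [x]. *)
have [[W sW HW]|[U sU HU]] := HJ good.
  pose rich x := d / 4 <= dens R (fun v => A (wcat (wmap Some (sub_eval W v)) x)).
  pose Q L x := is_line L && [forall a, A (wcat (wmap Some (sub_eval W (fill L a))) x)].
  have [||L] := @dens_pigeonhole R _ {ffun J0 -> option K} rich Q (d / 4) ltac:(lra).
  - by move=> x /HJ0[L lL AL]; exists L; rewrite /Q lL; exact/forallP.
  - apply: reverse_markov; rewrite ?words_gt0 //; [lra|by move=> x; exact: dens_le1|].
    rewrite /dens exchange_avg; apply: (@le_trans _ _ (d - gam)); first lra.
    rewrite -[leLHS](avg_cst _ (card_words_gt0 J0 K0)); apply: le_avg => v.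
    exact: p_ge.
  move=> /[dup] /(dens_lt0 th0)[x /andP[lL _]] thQ.
  have /negP := HW _ lL; apply; apply: le_trans thQ _; apply: le_dens => {}x /andP[_].
  move=> /forallP AW; apply/forallP => a; rewrite fill_sub_some; exact: AW.
pose Ax x t := A (wcat (sub_eval U t) x).
pose Dx x a t := A (wcat (wmap Some (fill (sub_eval U t) a)) x).
(* Otherwise [sub_eval U t], read as a line and followed by [x], would lie in the line-free set [A]
   at every letter, [None] included. *)
have AD x t : ~ (Ax x t /\ [forall a, Dx x a t]).
  move=> [Axt /forallP Dxt]; have /andP[lU _] := HU t.
  apply: (lfA (wcat (wmap (omap Some) (sub_eval U t)) (wmap Some x))).
    by apply: is_line_wcatl; rewrite is_line_map.
  move=> [a|]; rewrite fill_wcat fill_some; first by rewrite fill_map; exact: Dxt.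
  rewrite (_ : fill _ _ = sub_eval U t) //.
  by apply/ffunP => i; rewrite !ffunE; case: (match _ with inl _ => _ | _ => _ end).
pose f x t : R := (Ax x t)%:R - (d + gam).
(* By [AD] all of [A] lies in the complement of the intersection of the [Dx], which has density at
   most [1 - theta]; as [d * theta = 4 * gam], the average over [x] is at least [2 * gam]. *)
have [x hx] : exists x, gam < avg (fun t => (~~ [forall a, Dx x a t])%:R * f x t).
  apply: ltr_avg_exists; first exact: words_gt0.
  rewrite exchange_avg.
  apply: (@lt_le_trans _ _ (2 * gam)); first lra.
  rewrite -[leLHS](avg_cst _ (words_gt0 K M)); apply: le_avg => t.
  have -> : avg (fun x => (~~ [forall a, Dx x a t])%:R * f x t) =
      p (sub_eval U t) - (d + gam) + (d + gam) * dens R (fun x => [forall a, Dx x a t]).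
    rewrite /p /dens -avgZ -[X in _ - X](avg_cst _ (words_gt0 K N)) -avgB -avgD.
    apply: eq_avg => x; rewrite /f /Ax.
    case allD : [forall a, Dx x a t]; last by rewrite mul1r mulr0 addr0.
    case Axt : (A _) => /=; last by ring.
    by case: (@AD x t).
  have /andP[_ gU] := HU t.
  have : theta <= dens R (fun x => [forall a, Dx x a t]) by [].
  have := p_ge (sub_eval U t); set P := p _; set T := dens R _ => PP TT.
  have : (d + gam) * theta <= (d + gam) * T by rewrite ler_wpM2l //; lra.
  have : 0 <= gam * theta by rewrite mulr_ge0 // ltW.
  have : d * theta = 4 * gam by rewrite /gam; lra.
  lra.
pose E a b t := first_fail (fun c => Dx x c t) a b.
have [a ha] : exists a,
    gam / (#|K|%:R + 1) < avg (fun t => [forall b, E a b t]%:R * f x t).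
  apply: contrapT => /forallNP nE; suff : gam < gam by rewrite ltxx.
  apply: (lt_le_trans hx).
  rewrite (_ : avg _ = \sum_a avg (fun t => [forall b, E a b t]%:R * f x t)); last first.
    by rewrite -avg_sum; apply: eq_avg => t; rewrite first_failE mulr_suml.
  apply: (@le_trans _ _ (\sum_(a : K) gam / (#|K|%:R + 1))).
    by apply: ler_sum => a _; rewrite leNgt; apply/negP/nE.
  rewrite sumr_const -(mulr_natl (_ / _)) mulrA ler_pdivrMr; last by rewrite ltr_wpDl.
  by rewrite mulrDr mulr1 mulrC lerDl ltW.
(* [Dx x b] sees [t] only after [None] has been filled with [b]. *)
have iD b : insens b (Dx x b).
  by move=> t; rewrite /Dx fill_sub_eval.
have [|||W sW] := HM (E a) (f x).
- by move=> b t; rewrite /E /first_fail iD.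
- by move=> t; rewrite /f; case: (Ax x t) => /=; lra.
- apply: lt_le_trans ha _; rewrite le_eqVlt; apply/orP; left; apply/eqP.
  apply: eq_avg => t; congr (_%:R * _); congr nat_of_bool.
  apply/forallP/allP => [EE b _|EE b]; first exact: EE.
  by apply: EE; rewrite mem_enum.
(* A positive average of [f] is a density above [d + gam] on a subspace, which by the choice of [D]
   contains a line. *)
rewrite avgB avg_cst ?words_gt0 // subr_gt0 => /ltW/HD[L lL AL].
apply: (lfA (wcat (sub_eval (sub_some (sub_comp U W)) L) (wmap Some x))).
  apply: is_line_wcatl; apply: is_line_sub_eval => //.
  by apply: is_sub_some; exact: is_sub_comp.
by move=> c; rewrite fill_wcat fill_some fill_sub_some sub_evalE; exact: AL.
Qed.

(** If the statement failed at [delta], the infimum of the densities at which it holds would be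
    positive and critical. *)
Lemma DHJ_option (delta : R) : 0 < delta -> DHJ (option K) delta.
Proof.
move=> d0; apply: contrapT => nd.
pose S := [set d : R | DHJ (option K) d].
have Slb : lbound S delta.
  by move=> d Sd; rewrite leNgt; apply/negP => /ltW dd; apply: nd; exact: DHJ_le dd Sd.
have S2 : S 2.
  by exists void => A dA; have := le_trans dA (dens_le1 R A); rewrite lern1.
have iS : has_inf S by split; [exists 2|exists delta].
apply: (@DHJ_critical (inf S)).
- apply/andP; split; last exact: ge_inf iS.2 _ S2.
  by apply: lt_le_trans d0 _; apply: lb_le_inf => //; exists 2.
- move=> e e0; have [d Sd dS] := inf_adherent e0 iS.
  exact: DHJ_le (ltW dS) Sd.
- move=> e e0 Se; have := ge_inf iS.2 Se; lra.
Qed.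

End step.

Lemma DHJ_bij (K K' : finType) (h : K -> K') (g : K' -> K) (delta : R) :
  cancel h g -> cancel g h -> DHJ K delta -> DHJ K' delta.
Proof.
move=> hg gh [I HI]; exists I => A dA.
have wb : bijective (wmap h : {ffun I -> K} -> {ffun I -> K'}).
  by exists (wmap g) => x; apply/ffunP => i; rewrite !ffunE.
have [|L lL AL] := HI (fun x => A (wmap h x)).
  by rewrite /dens -(avg_bij (fun x => (A x)%:R) wb).
exists (wmap (omap h) L); first by rewrite is_line_map.
by move=> a; rewrite -(gh a) fill_map.
Qed.

Theorem density_hales_jewett (K : finType) (delta : R) :
  (0 < #|K|)%N -> 0 < delta -> DHJ K delta.
Proof.
move: K delta.
apply: finType_ind => [delta|K IHK delta _ d0|K K' h g hg gh IHK delta K0 d0].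
- by rewrite card_ord.
- have [/card0_eq K0|K0] := posnP #|K|.
    2: by apply: DHJ_option => // d; exact: IHK.
  have oK (a b : option K) : a = b.
    by case: a b => [a|] [b|] //; [have := K0 a|have := K0 a|have := K0 b].
  exists unit => A /(dens_lt0 d0)[x Ax]; exists [ffun=> None].
    by apply/existsP; exists tt; rewrite ffunE.
  by move=> a; rewrite (_ : fill _ _ = x) //; apply/ffunP => i; apply: oK.
apply: DHJ_bij hg gh _; apply: IHK => //.
by case/card_gt0P: K0 => a _; apply/card_gt0P; exists (g a).
Qed.

End density_hales_jewett.

(** * Recurrence along commuting actions *)

Lemma syndetic_sub (G : zmodType) (S S' : set G) :
  S `<=` S' -> syndetic S -> syndetic S'.
Proof.
move=> SS' [F fF SF]; exists F => //; rewrite -subTset -SF => _ [s Ss [f Ff <-]].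
by exists s; [exact: SS'|exists f].
Qed.

(* The finite sums of [g] are kept outside [S] one generator at a time, since
   finitely many translates of [S] do not cover [G]. *)
Lemma not_syndetic_sums (G : zmodType) (S : set G) (I : finType) : ~ syndetic S ->
  exists g : I -> G, forall P : pred I, (exists i, P i) -> ~ S (\sum_(i | P i) g i).
Proof.
move=> nS.
suff [g Sg] : exists g : 'I_#|I| -> G, forall P : pred 'I_#|I|,
    (exists i, P i) -> ~ S (\sum_(i | P i) g i).
  exists (g \o enum_rank) => P [i Pi].
  rewrite (reindex (@enum_val I I)) /=; last first.
    by apply: onW_bij; exists enum_rank; [exact: enum_valK|exact: enum_rankK].
  under eq_bigr do rewrite enum_valK.
  by apply: Sg; exists (enum_rank i); rewrite enum_rankK.
elim: #|I| => [|n [g Sg]]; first by exists (fun=> 0) => P [[]].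
(* Minus all subset sums, the empty one included: a point [h] outside [S + F] has all its sums with
   the old generators outside [S]. *)
pose F := [set - \sum_(i | B i) g i | B in [set: {ffun 'I_n -> bool}]].
have [h Sh] : exists h, forall B : {ffun 'I_n -> bool}, ~ S (h + \sum_(i | B i) g i).
  apply: contrapT => /forallNP nh; apply: nS; exists F.
    exact: finite_image.
  rewrite -subTset => h _; have /existsNP[B /contrapT SB] := nh h.
  exists (h + \sum_(i | B i) g i) => //.
  by exists (- \sum_(i | B i) g i); [exists B|rewrite addrK].
exists (fun i => if unlift ord0 i is Some j then g j else h) => P exP.
rewrite big_mkcond big_ord_recl unlift_none /=.
have -> : \sum_(i < n) (if P (lift ord0 i) then
      if unlift ord0 (lift ord0 i) is Some j then g j else h else 0) =
    \sum_(i | P (lift ord0 i)) g i.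
  by rewrite [RHS]big_mkcond; apply: eq_bigr => i _; rewrite liftK.
case P0 : (P ord0).
  have := Sh [ffun i => P (lift ord0 i)].
  by under eq_bigl do rewrite ffunE.
rewrite add0r; apply: Sg; case: exP => i Pi.
by case: (unliftP ord0 i) Pi => [j ->|->]; [exists j|rewrite P0].
Qed.

(** * Lines of events in a probability space *)

Section probability_line.
Variables (R : realType) (d : measure_display) (Z : measurableType d).
Variables (theta : probability Z R) (K : finType).
Local Open Scope ereal_scope.

(** A point [z] lies in less than a proportion [delta / 2] of the [B w], or in all sets of some
    line. If no line had measure at least [c], integration would bound the average measure of the
    [B w] by [delta / 2 + delta / 4]. *)
Lemma probability_line (delta : R) : (0 < #|K|)%N -> (0 < delta)%R ->
  exists I : finType, exists2 c : R, (0 < c)%R &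
  forall B : {ffun I -> K} -> set Z, (forall w, measurable (B w)) ->
  (forall w, delta%:E <= theta (B w)) ->
  exists2 L, is_line L & c%:E <= theta (\bigcap_a B (fill L a)).
Proof.
move=> K0 d0; have [I HI] := density_hales_jewett K0 (divr_gt0 d0 (ltr0n R 2)).
have W0 := card_words_gt0 I K0.
have L0 : (0 < #|{ffun I -> option K}|)%N by rewrite card_words_gt0 // card_option.
exists I, (delta / 4 / #|{ffun I -> option K}|%:R)%R; first by rewrite !divr_gt0 // ltr0n.
move=> B mB thB; apply: contrapT => nL.
pose BL L := if is_line L then \bigcap_a B (fill L a) else set0.
have mBL L : measurable (BL L).
  rewrite /BL; case: ifP => // _; apply: fin_bigcap_measurable => //.
  exact: finite_finset.
have BLc L : theta (BL L) <= (delta / 4 / #|{ffun I -> option K}|%:R)%:E.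
  rewrite /BL; case: ifPn => [lL|_]; last first.
    by rewrite measure0 lee_fin !divr_ge0 // ltW.
  by rewrite leNgt; apply/negP => /ltW ?; apply: nL; exists L.
pose q : R := #|{ffun I -> K}|%:R.
have q0 : (0 < q)%R by rewrite ltr0n.
have mind (D : set Z) : measurable D ->
    measurable_fun setT (fun z => (\1_D z)%:E : \bar R).
  by move=> mD; apply/measurable_EFinP; exact: measurable_indic.
have msum (T : finType) (D : T -> set Z) : (forall t, measurable (D t)) ->
    measurable_fun setT (fun z => \sum_t (\1_(D t) z)%:E : \bar R).
  by move=> mD; apply: emeasurable_sum => t; exact: mind.
have isum (T : finType) (D : T -> set Z) : (forall t, measurable (D t)) ->
    \int[theta]_z (\sum_t (\1_(D t) z)%:E) = \sum_t theta (D t).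
  move=> mD; rewrite ge0_integral_sum //; last by move=> t; exact: mind.
  by apply: eq_bigr => t _; rewrite integral_indic // setIT.
have : \int[theta]_z (\sum_w (\1_(B w) z)%:E) <=
    \int[theta]_z (q%:E * ((delta / 2)%:E + \sum_L (\1_(BL L) z)%:E)).
  apply: ge0_le_integral => //.
  - by move=> z _; apply: sume_ge0 => w _; rewrite lee_fin.
  - exact: msum.
  - apply: emeasurable_funM; first exact: measurable_cst.
    by apply: emeasurable_funD; [exact: measurable_cst|exact: msum].
  move=> z _; rewrite !sumEFin -EFinD -EFinM lee_fin.
  rewrite -ler_pdivrMl // mulrC.
  have -> : ((\sum_w \1_(B w) z) / q)%R = dens R (fun w => z \in B w).
    by rewrite /dens /avg -/q; congr (_ / _)%R; apply: eq_bigr => w _; rewrite indicE.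
  have [/HI[L lL zL]|/ltW dz] := leP (delta / 2)%R (dens R (fun w => z \in B w)).
    rewrite (bigD1 L) //= indicE mem_set; last first.
      by rewrite /BL lL => a _; have := zL a; rewrite inE.
    apply: le_trans (dens_le1 R _) _; rewrite addrCA lerDl addr_ge0 //.
      by rewrite divr_ge0 // ltW.
    by apply: sumr_ge0.
  by apply: le_trans dz _; rewrite lerDl sumr_ge0.
have sum_ge0 z : 0 <= \sum_L (\1_(BL L) z)%:E :> \bar R.
  by apply: sume_ge0 => L _; rewrite lee_fin.
have half_ge0 : 0 <= (delta / 2)%:E :> \bar R by rewrite lee_fin divr_ge0 // ltW.
rewrite (ge0_integralZl_EFin _ measurableT _ _ (ltW q0)) //; last 2 first.
- by move=> z _; rewrite adde_ge0.
- by apply: emeasurable_funD; [exact: measurable_cst|exact: msum].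
rewrite ge0_integralD //; last exact: msum.
rewrite !isum // integral_cst //= probability_setT mule1.
apply/negP; rewrite -ltNge.
apply: (@lt_le_trans _ _ (\sum_(w : {ffun I -> K}) delta%:E)); last exact: lee_sum.
apply: (@le_lt_trans _ _ (q%:E * ((delta / 2)%:E +
   \sum_(L : {ffun I -> option K}) (delta / 4 / #|{ffun I -> option K}|%:R)%:E))).
  by rewrite lee_pmul2l // leeD2l // lee_sum.
rewrite !sumEFin -EFinD -EFinM lte_fin !sumr_const -(mulr_natl delta) -/q.
rewrite -(mulr_natl (_ / _)%R) [(_%:R * _)%R]mulrC divfK ?pnatr_eq0 -?lt0n //.
by rewrite ltr_pM2l //; lra.
Qed.

End probability_line.

Lemma continuous_measurable_borel (G : topologicalZmodType) (h : G -> G) :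
  continuous h -> measurable_fun [set: borelType G] (h : borelType G -> borelType G).
Proof.
move=> /continuousP hc.
apply: (@measurability _ _ (borelType G) (borelType G) setT h (@open G)) => //.
move=> _ [B oB <-].
by rewrite setTI; apply: sub_sigma_algebra; exact: hc.
Qed.

Section recurrence.
Variables (R : realType) (G : topologicalZmodType).
Variables (d : measure_display) (Z : measurableType d) (theta : probability Z R).
Variables (r : nat) (a : 'I_r -> G -> Z -> Z).
Hypotheses (a_action : forall k, borel_action (a k))
  (a_preserves : forall k, preserves theta (a k))
  (a_commute : forall j k, j != k -> commuting_actions (a j) (a k)).

Lemma act0 k z : a k 0 z = z. Proof. by case: (a_action k). Qed.

Lemma actD k g h z : a k (g + h) z = a k g (a k h z).
Proof. by case: (a_action k). Qed.

Lemma act_image k g A : a k g @` A = a k (- g) @^-1` A.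
Proof.
apply/seteqP; split => [_ [z Az <-]|z /= Az] /=.
  by rewrite -actD addNr act0.
by exists (a k (- g) z); rewrite // -actD addrN act0.
Qed.

Lemma measurable_act k g : measurable_fun setT (a k g).
Proof.
case: (a_action k) => _ _ mk.
exact: (measurable_fun_pair2 (g : borelType G) mk).
Qed.

(** The commuting actions combined into one action of [G^r], along a list of indices so that
    induction is available. *)
Definition joint_act (s : seq 'I_r) (x : 'I_r -> G) (z : Z) : Z :=
  foldr (fun k => a k (x k)) z s.

Lemma joint_act_comm s x k g z : k \notin s ->
  a k g (joint_act s x z) = joint_act s x (a k g z).
Proof.
elim: s => // j s IHs; rewrite inE negb_or => /andP[kj ks] /=.
by rewrite a_commute // IHs.
Qed.

Lemma joint_actD s x y z : uniq s ->
  joint_act s (fun k => x k + y k) z = joint_act s x (joint_act s y z).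
Proof.
elim: s => //= k s IHs /andP[ks us].
by rewrite actD IHs // joint_act_comm.
Qed.

Lemma joint_act_single s (x : 'I_r -> G) k z : uniq s -> k \in s ->
  (forall j, j != k -> x j = 0) -> joint_act s x z = a k (x k) z.
Proof.
move=> us ks x0.
have act_id t : k \notin t -> joint_act t x z = z.
  elim: t => // j t IHt; rewrite inE negb_or => /andP[kj kt] /=.
  by rewrite IHt // x0 ?act0 // eq_sym.
elim: s us ks => //= j s IHs /andP[js us]; rewrite inE.
have [kj|kj] := eqVneq k j; first by subst j; rewrite act_id.
by move=> /= ks; rewrite IHs // x0 ?act0 // eq_sym.
Qed.

Lemma joint_act_preimage s x B : measurable B ->
  measurable (joint_act s x @^-1` B) /\ theta (joint_act s x @^-1` B) = theta B.
Proof.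
elim: s B => [|k s IHs] B mB; first by [].
have mkB : measurable (a k (x k) @^-1` B).
  by rewrite -[X in measurable X]setTI; exact: measurable_act.
have [? E] := IHs _ mkB; split => //.
by rewrite -(a_preserves k (x k) mB) -E.
Qed.

Definition joint_set (A : set Z) (g : G) : set Z :=
  A `&` \bigcap_(k in [set: 'I_r]) (a k (- g) @^-1` A).

Lemma measurable_joint_set_fiber A g : measurable A -> measurable (joint_set A g).
Proof.
move=> mA; apply: measurableI => //; apply: fin_bigcap_measurable => [|k _].
  exact: finite_finset.
by rewrite -[X in measurable X]setTI; exact: measurable_act.
Qed.

(* The words over [option 'I_r] index the elements [w] of [G^r] with
   [w_k = - sum_(i | w i = Some k) g_i]; the points of a line then differ from
   its value at [None] by [- h] in one single coordinate, where [h] is the sum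
   of the [g_i] over the wildcards. *)
Lemma syndetic_recurrence (A : set Z) : measurable A -> (0 < theta A)%E ->
  exists2 c : R, 0 < c & syndetic [set g | (c%:E <= theta (joint_set A g))%E].
Proof.
move=> mA A0.
have thA : theta A = (fine (theta A))%:E.
  by rewrite fineK // fin_num_measure.
have d0 : 0 < fine (theta A) by rewrite -lte_fin -thA.
have [|I [c c0 HI]] := @probability_line R _ _ theta (option 'I_r) _ _ d0.
  by rewrite card_option.
exists c => //; apply: contrapT => /(not_syndetic_sums I)[g gS].
pose x (w : {ffun I -> option 'I_r}) k := - \sum_(i | w i == Some k) g i.
pose T w := joint_act (enum 'I_r) (x w).
have [||L lL thL] := HI (fun w => T w @^-1` A).
- by move=> w; have [] := joint_act_preimage (enum 'I_r) (x w) mA.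
- move=> w; have [_ ->] := joint_act_preimage (enum 'I_r) (x w) mA.
  by rewrite -thA.
pose h := \sum_(i | L i == None) g i.
have TSome k z : T (fill L (Some k)) z = a k (- h) (T (fill L None) z).
  have -> : a k (- h) (T (fill L None) z) =
      joint_act (enum 'I_r) (fun j => (if j == k then - h else 0)) (T (fill L None) z).
    rewrite (@joint_act_single _ _ k) ?enum_uniq ?mem_enum ?eqxx //.
    by move=> j /negPf ->.
  rewrite /T -joint_actD ?enum_uniq //; congr (joint_act _ _ z).
  apply/funext => j; rewrite /x /h.
  rewrite (bigID (fun i => L i == None)) /= opprD; congr (_ + _).
    have [->|jk] := eqVneq j k.
      congr (- _); apply: eq_bigl => i; rewrite ffunE.
      by case: (L i) => [b|]; rewrite ?andbF // eqxx.
    rewrite big1 ?oppr0 // => i; rewrite ffunE; case: (L i) => [b|] /=.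
      by rewrite andbF.
    by rewrite andbT => /eqP[jk']; rewrite jk' eqxx in jk.
  congr (- _); apply: eq_bigl => i; rewrite !ffunE.
  by case: (L i) => [b|] /=; rewrite ?andbT ?andbF.
apply: (gS (fun i => L i == None)); first exact/existsP.
rewrite /= -/h; apply: le_trans thL _.
(* [T (fill L None)] preserves the measure, and the preimage of [joint_set A h] under it contains
   the intersection over the line. *)
have [mTJ <-] := joint_act_preimage (enum 'I_r) (x (fill L None))
  (measurable_joint_set_fiber h mA).
apply: le_measure; rewrite ?inE //.
  apply: fin_bigcap_measurable => [|w _]; first exact: finite_finset.
  by have [] := joint_act_preimage (enum 'I_r) (x (fill L w)) mA.
move=> z Lz; split; first exact: (Lz None).
by move=> k _ /=; rewrite -TSome; exact: (Lz (Some k)).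
Qed.

(** The sets [joint_set A g] are the sections of one measurable subset of the product, so Tonelli
    applies. *)
Lemma measurable_joint_set A : measurable A ->
  measurable_fun [set: borelType G] (fun g => theta (joint_set A g)).
Proof.
move=> mA; pose E := [set p : borelType G * Z | joint_set A p.1 p.2].
have mE : measurable E.
  have -> : E = snd @^-1` A `&`
      \bigcap_(k in [set: 'I_r]) ((fun p => a k (- p.1) p.2) @^-1` A) by [].
  apply: measurableI.
    by rewrite -[X in measurable X]setTI; exact: measurable_snd.
  apply: fin_bigcap_measurable => [|k _]; first exact: finite_finset.
  have [_ _ mk] := a_action k.
  have mN : measurable_fun setT (fun p : borelType G * Z => (- p.1 : borelType G, p.2)).
    apply: measurable_fun_pair; last exact: measurable_snd.
    apply: (measurableT_comp _ measurable_fst).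
    by apply: continuous_measurable_borel; exact: opp_continuous.
  by rewrite -[X in measurable X]setTI; exact: (measurableT_comp mk mN).
have := measurable_fun_xsection theta mE.
apply: eq_measurable_fun => g _ /=; congr (theta _).
by apply/seteqP; split => z; rewrite /xsection /E /= inE.
Qed.

End recurrence.

(** * Averages along Folner sequences *)

Section measure_lemmas.
Local Open Scope ereal_scope.
Variables (R : realType) (d : measure_display) (T : measurableType d).
Variable mu : {measure set T -> \bar R}.

Lemma le_completed (A B : set T) : A `<=` B -> completed mu A <= completed mu B.
Proof. exact: le_outer_measure. Qed.

Lemma completedE (A : set T) : measurable A -> completed mu A = mu A.
Proof. exact: measurable_mu_extE. Qed.

Lemma le_measure_completed (A B : set T) :
  measurable A -> A `<=` B -> mu A <= completed mu B.
Proof. by move=> mA /le_completed; rewrite completedE. Qed.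

(** Lets [A] be replaced by a Borel subset of positive measure, which can only decrease the measures
    of its intersections. *)
Lemma completed_gt0 (A : set T) : completed_algebra_gen mu A ->
  0 < completed mu A ->
  exists A0, [/\ measurable A0, A0 `<=` A & 0 < mu A0].
Proof.
move=> [A0 mA0 [N [N' [mN' N'0 NN']] <-]] A_gt0.
exists A0; split => //; apply: lt_le_trans A_gt0 _.
apply: (@le_trans _ _ (completed mu (A0 `|` N'))).
  by apply: le_completed; exact: setUS.
rewrite completedE; last exact: measurableU.
by apply: le_trans (measureU2 mu mA0 mN') _; rewrite [X in _ + X]N'0 adde0.
Qed.

Lemma measure_bigsetU_le (I : Type) (s : seq I) (B : I -> set T) :
  (forall i, measurable (B i)) ->
  mu (\big[setU/set0]_(i <- s) B i) <= \sum_(i <- s) mu (B i).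
Proof.
move=> mB; elim: s => [|i s IHs]; first by rewrite !big_nil measure0.
rewrite !big_cons; apply: le_trans (measureU2 mu _ _) _ => //.
  exact: bigsetU_measurable.
exact: leeD2l.
Qed.

(* Unlike [ge0_le_integral], without measurability assumptions. *)
Lemma le_nnintegral (D : set T) (f g : T -> \bar R) :
  (forall x, 0 <= f x) -> (forall x, f x <= g x) ->
  \int[mu]_(x in D) f x <= \int[mu]_(x in D) g x.
Proof.
move=> f0 fg; have g0 x : 0 <= g x := le_trans (f0 x) (fg x).
rewrite !ge0_integralE //; apply: ereal_sup_le => _ [h /= hf <-].
exists h => //= x; apply: le_trans (hf x) _.
by apply: lee_restrict => y _; exact: fg.
Qed.

End measure_lemmas.

Lemma limn_einf_gt0 (R : realType) (u : (\bar R)^nat) (c : R) :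
  0 < c -> (\forall n \near \oo, (c%:E <= u n)%E) -> (0 < limn_einf u)%E.
Proof.
move=> c0 [N _ Nu]; rewrite limn_einf_lim.
apply: (@lt_le_trans _ _ c%:E); first by rewrite lte_fin.
apply: (@le_trans _ _ (einfs u N)).
  by apply: le_ereal_inf_tmp => _ [n /= Nn <-]; exact: Nu.
rewrite (cvg_lim _ (@cvg_einfs_sup R u)) //.
by apply: ereal_sup_ubound; exists N.
Qed.

(** * Syndetic sets along Folner sequences *)

Section folner.
Variables (R : realType) (G : topologicalZmodType).
Variable mG : {measure set (borelType G) -> \bar R}.
Hypothesis mG_haar : haar_measure mG.

Lemma closed_borel (B : set G) : closed B -> measurable (B : set (borelType G)).
Proof.
move=> cB; rewrite -[B]setCK; apply: (@measurableC _ (borelType G)).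
by apply: sub_sigma_algebra; exact: closed_openC.
Qed.

Lemma precompact_fin_measure (B : set G) :
  measurable (B : set (borelType G)) -> precompact B -> mG B \is a fin_num.
Proof.
move=> mB; rewrite precompactE => cB; rewrite ge0_fin_numE ?measure_ge0 //.
have [_ fin _] := mG_haar; apply: le_lt_trans (fin _ cB).
apply: le_measure; rewrite ?inE //; last exact: subset_closure.
by apply: closed_borel; exact: closed_closure.
Qed.

Definition translate (g : G) (B : set G) : set G := [set g + x | x in B].

Lemma translateE (g : G) (B : set G) :
  translate g B = (fun x => - g + x) @^-1` B.
Proof.
apply/seteqP; split => [_ [x Bx <-]|x Bx] /=; first by rewrite addKr.
by exists (- g + x); rewrite ?addNKr.
Qed.

Lemma measurable_translate (g : G) (B : set G) : measurable (B : set (borelType G)) ->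
  measurable (translate g B : set (borelType G)).
Proof.
move=> mB; rewrite translateE -[X in measurable X]setTI.
have gc : continuous (fun x : G => - g + x).
  move=> x.
  apply: (@continuous_comp _ _ _ (fun x => (- g, x)) (fun x : G * G => x.1 + x.2)).
    by apply: cvg_pair => /=; [exact: cvg_cst|exact: cvg_id].
  exact: add_continuous.
exact: (continuous_measurable_borel gc).
Qed.

(** Finitely many translates of [S] cover [F n], and by the Folner property each meets [F n] in
    hardly more measure than [S] does; so [S] fills a fixed proportion of [F n]. *)
Lemma folner_syndetic (F : (set G)^nat) (S : set G) :
  strong_folner mG F -> measurable (S : set (borelType G)) -> syndetic S ->
  exists2 c : R, 0 < c &
    \forall n \near \oo, (c%:E * mG (F n) <= mG (F n `&` S))%E.
Proof.
move=> [hF folF _] mS [_ /finite_seqP[s ->] sS].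
(* Errors of [1 / (2 * N)] for each translate add up to less than one half. *)
pose N : R := (size s)%:R + 1; have N0 : 0 < N by rewrite ltr_wpDl.
exists (2 * N)^-1; first by rewrite invr_gt0 mulr_gt0.
(* With this choice [F n + C] contains [F n] and all its translates by [- f]. *)
pose C := [set` 0 :: map -%R s] : set G.
have cC : compact C by apply: finite_compact; exact: finite_seq.
have C0 : C 0 by rewrite /C /= inE eqxx.
have e0 : ((1 : \bar R) < (1 + (2 * N)^-1)%R%:E)%E.
  by rewrite lte_fin ltrDl invr_gt0 mulr_gt0.
have near1 : \forall n \near \oo, (completed mG [set (x + y)%R | x in F n & y in C] /
    mG (F n) < (1 + (2 * N)^-1)%R%:E)%E.
  have nb := open_nbhs_nbhs (conj (@open_ereal_lt_ereal R _) e0).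
  exact: (folF C cC (ex_intro _ _ C0) _ nb).
near=> n.
have : (completed mG [set (x + y)%R | x in F n & y in C] /
    mG (F n) < (1 + (2 * N)^-1)%R%:E)%E by near: n.
have [mF pF F0] := hF n.
have := precompact_fin_measure mF pF; move: F0.
have [_ _ mG_transl] := mG_haar.
move E : (mG (F n)) => m; case: m E => // m Fm; rewrite lte_fin => m0 _.
rewrite inver gt_eqF // => ratio.
have {ratio} FC_lt : (completed mG [set (x + y)%R | x in F n & y in C] <
    ((1 + (2 * N)^-1) * m)%R%:E)%E.
  by move: ratio; rewrite lte_pdivrMr // EFinM.
have FS_fin : mG (F n `&` S) \is a fin_num.
  rewrite ge0_fin_numE ?measure_ge0 //; apply: (@le_lt_trans _ _ m%:E); last exact: ltry.
  rewrite -Fm; apply: le_measure; rewrite ?inE //.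
  exact: (@measurableI _ (borelType G)).
have mU f : measurable (translate f S : set (borelType G)).
  exact: measurable_translate.
have mT f : measurable (translate (- f)%R (F n) : set (borelType G)).
  exact: measurable_translate.
have diff_le f : f \in s ->
    (mG (translate (- f)%R (F n) `\` F n) <= ((2 * N)^-1 * m)%R%:E)%E.
  move=> fs.
  have mD : measurable (translate (- f)%R (F n) `\` F n : set (borelType G)).
    exact: (@measurableD _ (borelType G)).
  have : (mG (translate (- f)%R (F n) `\` F n) + m%:E < ((1 + (2 * N)^-1) * m)%R%:E)%E.
    apply: le_lt_trans FC_lt; rewrite -Fm -measureU //; last first.
      by rewrite setDE -setIA setICl setI0.
    apply: le_measure_completed; first exact: (@measurableU _ (borelType G)).
    move=> x [[[y Fy <-] _]|Fx].
      exists y => //; exists (- f); last by rewrite addrC.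
      by rewrite /C /= inE map_f ?orbT.
    by exists x => //; exists 0; rewrite ?addr0.
  have : (0 <= mG (translate (- f)%R (F n) `\` F n))%E by exact: measure_ge0.
  case: (mG (translate (- f)%R (F n) `\` F n)) => [y||] //.
  rewrite -EFinD lte_fin !lee_fin.
  lra.
have cover_le f : f \in s ->
    (mG (F n `&` translate f S) <= ((2 * N)^-1 * m)%R%:E + mG (F n `&` S))%E.
  move=> fs; rewrite -(mG_transl (- f)); last exact: (@measurableI _ (borelType G)).
  apply: le_trans (leeD2r _ (diff_le f fs)).
  apply: le_trans (measureU2 mG _ _); first last.
  - exact: (@measurableI _ (borelType G)).
  - exact: (@measurableD _ (borelType G)).
  apply: le_measure; rewrite ?inE.
  - by apply: measurable_translate; exact: (@measurableI _ (borelType G)).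
  - apply: (@measurableU _ (borelType G)); first exact: (@measurableD _ (borelType G)).
    exact: (@measurableI _ (borelType G)).
  move=> _ [x [Fx [y Sy xE]] <-]; subst x; rewrite addKr.
  have [Fy|nFy] := pselect (F n y); [by right|left; split => //].
  exists (f + y); [exact: Fx|exact: addKr].
have : (m%:E <= \sum_(f <- s) mG (F n `&` translate f S))%E.
  rewrite -Fm.
  apply: (@le_trans _ _ (mG (\big[setU/set0]_(f <- s) (F n `&` translate f S)))).
    apply: le_measure; rewrite ?inE //.
      by apply: bigsetU_measurable => f _; exact: (@measurableI _ (borelType G)).
    move=> x Fx; have : setT x by [].
    rewrite -sS => -[y Sy [f fs yfx]].
    rewrite -bigcup_seq; exists f => //; split => //.
    by exists y => //; rewrite addrC.
  by apply: measure_bigsetU_le => f; exact: (@measurableI _ (borelType G)).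
have {}cover_le : (\sum_(f <- s) mG (F n `&` translate f S) <=
    \sum_(f <- s) (((2 * N)^-1 * m)%R%:E + mG (F n `&` S)))%E.
  by rewrite big_seq [leRHS]big_seq; apply: lee_sum.
move=> /le_trans/(_ cover_le).
have : (0 <= mG (F n `&` S))%E by exact: measure_ge0.
rewrite -(fineK FS_fin); move: (fine _) => v v0.
under eq_bigr do rewrite -EFinD.
rewrite sumEFin -EFinM !lee_fin => mv; rewrite lee_fin in v0.
rewrite big_const_seq count_predT iter_addr_0 -(mulr_natl (_ + _)) in mv.
have Ns : (size s)%:R = N - 1 :> R by rewrite /N addrK.
rewrite Ns in mv; rewrite ler_pdivrMl ?mulr_gt0 //.
have : (2 * N)^-1 * m * (2 * N) = m.
  by rewrite mulrC mulrA mulfV ?mul1r // gt_eqF // mulr_gt0.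
have : 0 <= (2 * N)^-1 * m by rewrite mulr_ge0 ?invr_ge0 ?mulr_ge0 // ltW.
nra.
Unshelve. all: by end_near.
Qed.

End folner.

Theorem theorem4p1 (R : realType) (G : topologicalZmodType)
    (G_hausdorff : hausdorff_space G)
    (G_lc : locally_compact [set: G])
    (G_sc : @second_countable G)
    (mG : {measure set (borelType G) -> \bar R}) (mG_haar : haar_measure mG)
    (d : measure_display) (Z : measurableType d)
    (Z_std : standard_borel R Z) (theta : probability Z R)
    (r : nat) (a : 'I_r -> G -> Z -> Z)
    (a_action : forall k, borel_action (a k))
    (a_preserves : forall k, preserves theta (a k))
    (a_commute : forall j k, j != k -> commuting_actions (a j) (a k))
    (A : set Z) (A_meas : completed_algebra_gen theta A)
    (A_pos : (0 < completed theta A)%E) :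
  (exists c : R, 0 < c /\
     syndetic [set g : G |
       (c%:E <= completed theta
                  (A `&` \bigcap_(k in [set: 'I_r]) (a k g @` A)))%E]) /\
  (forall F : (set G)^nat, strong_folner mG F ->
     (0 < limn_einf (fun n => (mG (F n))^-1 *
            \int[mG]_(g in F n)
               completed theta
                 (A `&` \bigcap_(k in [set: 'I_r]) (a k g @` A))))%E).
Proof.
have [A0 [mA0 A0A A0_gt0]] := completed_gt0 A_meas A_pos.
have [c c0 synS] := syndetic_recurrence a_action a_preserves a_commute mA0 A0_gt0.
set S := [set g | _] in synS.
pose phi g := completed theta (A `&` \bigcap_(k in [set: 'I_r]) (a k g @` A)).
have phi_ge g : (theta (joint_set a A0 g) <= phi g)%E.
  apply: le_measure_completed; first exact: measurable_joint_set_fiber.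
  apply: setISS => //.
  apply: subset_bigcap => k _; rewrite act_image //.
  exact: preimage_subset.
split.
  exists c; split => //; apply: syndetic_sub synS => g; rewrite /S /= => cg.
  exact: le_trans cg (phi_ge g).
move=> F folF.
have mS : measurable (S : set (borelType G)).
  have := emeasurable_fun_c_infty measurableT
    (measurable_joint_set theta a_action mA0) c%:E.
  by rewrite setTI.
have [c' c'0 near_c'] := folner_syndetic mG_haar folF mS synS.
(* Eventually [S] fills a proportion [c'] of [F n], and the integrand is at least [c] on [S]. *)
apply: (@limn_einf_gt0 R _ (c * c')); first exact: mulr_gt0.
move: near_c'; apply: filterS => n cn.
have [hF _ _] := folF; have [mF pF F0] := hF n.
have := precompact_fin_measure mG_haar mF pF.
have : (c%:E * mG (F n `&` S) <= \int[mG]_(g in F n) phi g)%E.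
  apply: (@le_trans _ _ (\int[mG]_(g in F n) (c%:E * (\1_S g)%:E)))%E; last first.
    apply: le_nnintegral => g.
      by rewrite mule_ge0 ?lee_fin // ltW.
    rewrite indicE; case: (boolP (g \in S)) => [|_].
      by rewrite inE mule1 => Sg; exact: le_trans Sg (phi_ge g).
    by rewrite mule0; exact: le_trans (measure_ge0 _ _) (phi_ge g).
  rewrite ge0_integralZl_EFin //; last 2 first.
  - by apply/measurable_EFinP; exact: measurable_indic.
  - exact: ltW.
  by rewrite integral_indic // setIC.
move=> cint Ffin; move: F0 cn; rewrite -(fineK Ffin).
move: (fine _) => m; rewrite lte_fin => m0 cn.
rewrite inver gt_eqF // lee_pdivlMl //; apply: le_trans cint.
have -> : (m%:E * (c * c')%:E = c%:E * (c'%:E * m%:E))%E.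
  by rewrite -!EFinM mulrC mulrA.
by rewrite lee_pmul2l.
Qed.
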